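(* Let $\mathcal{C}$ be a root class of groups, let $G$ be the free product of a family of residually $\mathcal{C}$-groups $A_i$ ($i \in \mathcal{I}$), and let $H$ be a subgroup of $G$ satisfying a non-trivial identity. Then $H$ is $\mathcal{C}$-defective in $G$ if and only if $H$ is conjugate in $G$ to a subgroup $H'$ of $A_i$ for some $i \in \mathcal{I}$ such that $H'$ is $\mathcal{C}$-defective in the group $A_i$.
   Context: Classes of groups are, as usual, closed under isomorphism. A class of groups $\mathcal{C}$ is a root class if it contains non-trivial groups and is closed under taking subgroups and unrestricted wreath products (the unrestricted wreath product of $X$ and $Y$ is the semidirect product of the full Cartesian power $X^Y$ by $Y$, with $Y$ acting by permuting coordinates via translation). A subgroup $Y$ of a group $X$ is $\mathcal{C}$-separable in $X$ if for any $x \in X \setminus Y$ there is a homomorphism $\sigma$ of $X$ onto a group from $\mathcal{C}$ with $x\sigma \notin Y\sigma$. A group $X$ is residually a $\mathcal{C}$-group (a residually $\mathcal{C}$-group) if its trivial subgroup is $\mathcal{C}$-separable in $X$. $\mathfrak{P}(\mathcal{C})$ is the following set of primes: if $\mathcal{C}$ contains a non-periodic group, it is the set of all primes; otherwise, a prime $p$ belongs to it if and only if $p$ divides the order of an element of some group in $\mathcal{C}$. A subgroup $Y$ of $X$ is $\mathfrak{P}(\mathcal{C})'$-isolated in $X$ if for each $x \in X$ and each prime $q \notin \mathfrak{P}(\mathcal{C})$, $x^q \in Y$ implies $x \in Y$. A subgroup of $X$ is $\mathcal{C}$-defective in $X$ if it is $\mathfrak{P}(\mathcal{C})'$-isolated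 in $X$ but not $\mathcal{C}$-separable in $X$. A group satisfies a non-trivial identity if there is a non-trivial element $w(x_1,\dots,x_k)$ of some free group which takes the value $1$ under every substitution of elements of the group for the variables. Free products are ordinary free products, and the free factors are regarded as subgroups of the free product. *)

(* Defs.v *)
From HB Require Import structures.
From mathcomp Require Import all_boot all_classical.

Set Implicit Arguments.
Unset Strict Implicit.
Unset Printing Implicit Defensive.

Local Open Scope classical_set_scope.
Local Open Scope group_scope.

Notation ghom X Y := (UMagmaMorphism.type X Y).

Definition is_subgroup (X : groupType) (H : set X) : Prop :=
  group_closed (mem H).

(* The carrier is X^Y * Y, where y : Y acts on the full Cartesian power X^Y by
   sending g to (fun t => g (t * y)). *)
Section Wreath.
Variables X Y : groupType.

Definition wreath : Type := ((Y -> X) * Y)%type.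

HB.instance Definition _ := Choice.on wreath.

Definition wreath_mul (u v : wreath) : wreath :=
  (fun t => u.1 t * v.1 (t * u.2), u.2 * v.2).
Definition wreath_one : wreath := (fun=> 1, 1).
Definition wreath_inv (u : wreath) : wreath :=
  (fun t => (u.1 (t * u.2^-1))^-1, u.2^-1).

Lemma wreath_mulA : associative wreath_mul.
Proof.
move=> u v w; congr pair; last exact: mulgA.
by apply/funext => t /=; rewrite !mulgA.
Qed.

Lemma wreath_mul1g : left_id wreath_one wreath_mul.
Proof.
case=> f y; congr pair; last exact: mul1g.
by apply/funext => t /=; rewrite mul1g mulg1.
Qed.

Lemma wreath_mulg1 : right_id wreath_one wreath_mul.
Proof.
case=> f y; congr pair; last exact: mulg1.
by apply/funext => t /=; rewrite mulg1.
Qed.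

Lemma wreath_mulVg : left_inverse wreath_one wreath_inv wreath_mul.
Proof.
case=> f y; congr pair; last exact: mulVg.
by apply/funext => t /=; rewrite mulVg.
Qed.

Lemma wreath_mulgV : right_inverse wreath_one wreath_inv wreath_mul.
Proof.
case=> f y; congr pair; last exact: mulgV.
by apply/funext => t /=; rewrite mulgK mulgV.
Qed.

HB.instance Definition _ := isGroup.Build wreath
  wreath_mulA wreath_mul1g wreath_mulg1 wreath_mulVg wreath_mulgV.

End Wreath.

(* A class of groups is a predicate C : groupType -> Prop.  As there is no type
   of subgroups of a groupType, closure under subgroups is stated for the
   domains of injective homomorphisms. *)
Record root_class (C : groupType -> Prop) : Prop := RootClass {
  root_class_iso : forall (X Y : groupType) (f : ghom X Y),
    bijective f -> C X -> C Y;
  root_class_nontrivial : exists (X : groupType) (x : X), C X /\ x <> 1;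
  root_class_subgroup : forall (X Y : groupType) (f : ghom Y X),
    injective f -> C X -> C Y;
  root_class_wreath : forall X Y : groupType, C X -> C Y -> C (wreath X Y)
}.

Definition separable (C : groupType -> Prop) (X : groupType) (Y : set X) :
    Prop :=
  forall x : X, ~ Y x ->
    exists (K : groupType) (s : ghom X K),
      [/\ C K, forall k : K, exists z : X, s z = k & ~ (s @` Y) (s x)].

Definition residually (C : groupType -> Prop) (X : groupType) : Prop :=
  separable C [set 1 : X].

Definition periodic (X : groupType) : Prop :=
  forall x : X, exists2 n : nat, (0 < n)%N & x ^+ n = 1.

Definition has_order (X : groupType) (x : X) (n : nat) : Prop :=
  [/\ (0 < n)%N, x ^+ n = 1 &
      forall m : nat, (0 < m)%N -> x ^+ m = 1 -> (n <= m)%N].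

Definition class_primes (C : groupType -> Prop) : set nat :=
  [set p | prime p /\
    ((exists X : groupType, C X /\ ~ periodic X) \/
     (exists (X : groupType) (x : X) (n : nat),
        [/\ C X, has_order x n & (p %| n)%N]))].

(* P is the set of primes allowed in orders, so the exponents q range over its
   complement among the primes. *)
Definition isolated (P : set nat) (X : groupType) (Y : set X) : Prop :=
  forall (x : X) (q : nat), prime q -> ~ P q -> Y (x ^+ q) -> Y x.

Definition defective (C : groupType -> Prop) (X : groupType) (Y : set X) :
    Prop :=
  isolated (class_primes C) Y /\ ~ separable C Y.

(* F is free with basis x_0, ..., x_{k-1}. *)
Definition free_basis (F : groupType) (k : nat) (x : 'I_k -> F) : Prop :=
  forall (K : groupType) (f : 'I_k -> K),
    exists phi : ghom F K, (forall i, phi (x i) = f i) /\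
      (forall psi : ghom F K, (forall i, psi (x i) = f i) -> psi =1 phi).

(* Substituting elements of H for the variables of w amounts to applying to w
   the homomorphism that sends the basis to these elements. *)
Definition satisfies_nontrivial_identity (G : groupType) (H : set G) : Prop :=
  exists (F : groupType) (k : nat) (x : 'I_k -> F) (w : F),
    [/\ free_basis x, w <> 1 &
        forall phi : ghom F G, (forall i, H (phi (x i))) -> phi w = 1].

(* G is the free product (coproduct of groups) of the A i; the factor A i is
   identified with its image under the embedding iota i. *)
Definition is_free_product (I : Type) (A : I -> groupType) (G : groupType)
    (iota : forall i, ghom (A i) G) : Prop :=
  forall (K : groupType) (f : forall i, ghom (A i) K),
    exists phi : ghom G K, (forall i a, phi (iota i a) = f i a) /\
      (forall psi : ghom G K, (forall i a, psi (iota i a) = f i a) ->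
         psi =1 phi).

(* Main.v *)
From mathcomp Require Import zify.
Require Import Defs.
From HB Require Import structures.
From mathcomp Require Import all_boot all_classical.

Set Implicit Arguments.
Unset Strict Implicit.
Unset Printing Implicit Defensive.

Local Open Scope classical_set_scope.
Local Open Scope group_scope.

(** The free product acts on its Bass-Serre tree, and edge stabilisers are
    trivial.  A subgroup [H] with an identity either fixes a vertex, so that it
    lies in a conjugate of a factor, or contains a hyperbolic element [h]
    ([factor_or_axial]).  The proof shows that in the second case an isolated
    [H] is separable, and in the first one that both separability and isolation
    can be tested in the factor.

    Suppose that [h] in [H] is hyperbolic.  If [h ^ y] differs from [h] and
    [h^-1], then the axes of [h] and [h ^ y] have a bounded overlap
    ([axes_overlap]), large powers of the two play ping-pong, and no identity
    can hold in the group that they generate.  Hence [H] preserves the axis of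
    [h] ([identity_axis]).  The centralizer of [h] is generated by one element
    [c] ([centralizer_cyclic]), every element of [H] centralises or inverts [c],
    and [H] meets the powers of [c] in the powers of some [c ^+ r].  An element
    outside [H] can then be separated from [H] as soon as [c] has images of
    order infinite or divisible by high powers of those primes that divide [r];
    by isolation these are primes of the class ([axis_stabiliser_separable]).

    All homomorphisms needed come from one construction ([edge_lift]).  Given
    [k : G -> K], embed [K] in the wreath product of [T] by [K] and conjugate
    the image of each factor by an arbitrary function from [K] to [T].  A
    coordinate of the image of a word is the product of labels in [T] met along
    the path that the word traces in [K].  A label supported on a single edge
    that is crossed once shows that the image is not trivial.  This gives that
    the free product is residually in the class ([free_product_residually]),
    hence the normal form of its elements, and images of [c] of large order
    ([axial_order]).

    If [H] is a subgroup of a factor, then separability in the factor gives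
    separability in [G] because the factor is a retract of a residually [C]
    group ([factor_separable]), and isolation passes from the factor to [G]
    because the factor is malnormal ([factor_isolated]).

    The tree enters through the length function [len] counting syllables, whose
    metric satisfies Gromov's four-point condition ([len_tree]). *)

(** * Homomorphisms and subgroups *)

(** Unlike [conjgE], its right-hand side uses the multiplication inferred from
    [groupType], so that [lia] identifies the resulting atoms. *)
Lemma conjE (X : groupType) (x y : X) : x ^ y = y^-1 * (x * y).
Proof. by []. Qed.

Section HomOf.
Variables (X Y : groupType) (f : X -> Y).
Hypothesis fM : {morph f : x y / x * y}.

Lemma mul_morph1 : f 1 = 1.
Proof. by apply: (@mulgI _ (f 1)); rewrite -fM !mulg1. Qed.

Definition hom_of : ghom X Y :=
  HB.pack f (isUMagmaMorphism.Build X Y f (conj mul_morph1 fM)).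

Lemma hom_ofE x : hom_of x = f x. Proof. by []. Qed.
End HomOf.

Lemma subgroup1 (X : groupType) (S : set X) : is_subgroup S -> S 1.
Proof. by case=> /set_mem. Qed.

Lemma subgroupV (X : groupType) (S : set X) x : is_subgroup S -> S x -> S x^-1.
Proof. by move=> hS Sx; apply/set_mem/(group_closedV hS)/mem_set. Qed.

Lemma subgroupM (X : groupType) (S : set X) x y :
  is_subgroup S -> S x -> S y -> S (x * y).
Proof. by move=> hS Sx Sy; apply/set_mem/(group_closedM hS); apply/mem_set. Qed.

Lemma subgroupX (X : groupType) (S : set X) x n :
  is_subgroup S -> S x -> S (x ^+ n).
Proof.
by move=> hS Sx; elim: n => [|n IH]; [exact: subgroup1|rewrite expgS; apply: subgroupM].
Qed.

Lemma subgroupI (X : groupType) (S : set X) :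
  S 1 -> (forall x y, S x -> S y -> S (x * y)) -> (forall x, S x -> S x^-1) ->
  is_subgroup S.
Proof.
move=> S1 SM SV; split; first exact: mem_set.
by move=> x y /set_mem Sx /set_mem Sy; apply/mem_set/SM => //; apply: SV.
Qed.

Section SubgroupType.
Variables (X : groupType) (S : set X).
Hypothesis hS : is_subgroup S.

Definition subgroup_type := {x : X | x \in S}.
HB.instance Definition _ := SubChoice.on subgroup_type.
HB.instance Definition _ :=
  SubChoice_isSubGroup.Build X (fun x => x \in S) subgroup_type hS.

Lemma subgroup_embedding : exists (Y : groupType) (j : ghom Y X),
  injective j /\ forall x, S x <-> exists y, j y = x.
Proof.
exists subgroup_type; exists (hom_of (@valM _ _ subgroup_type)).
split=> [|x]; first exact: val_inj.
split=> [Sx|[y <-]]; first by exists (exist _ x (mem_set Sx)).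
exact/set_mem/(valP y).
Qed.
End SubgroupType.

Lemma hom_image_subgroup (X Y : groupType) (f : ghom X Y) (S : set X) :
  is_subgroup S -> is_subgroup (f @` S).
Proof.
move=> hS; apply: subgroupI.
- by exists 1; [exact: subgroup1|exact: gmulf1].
- move=> _ _ [x Sx <-] [y Sy <-]; exists (x * y); last exact: gmulfM.
  exact: subgroupM.
- by move=> _ [x Sx <-]; exists x^-1; [exact: subgroupV|exact: gmulfV].
Qed.

Lemma setT_subgroup (X : groupType) : is_subgroup [set: X].
Proof. exact: subgroupI. Qed.

Lemma conj_subgroup (X : groupType) (S : set X) g :
  is_subgroup S -> is_subgroup [set h ^ g | h in S].
Proof.
move=> hS; apply: subgroupI.
- by exists 1; [exact: subgroup1|exact: conj1g].
- move=> _ _ [x Sx <-] [y Sy <-]; exists (x * y); last exact: conjMg.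
  exact: subgroupM.
- by move=> _ [x Sx <-]; exists x^-1; [exact: subgroupV|exact: conjVg].
Qed.

Lemma conj_set_comp (X : groupType) (S : set X) g h :
  [set z ^ h | z in [set y ^ g | y in S]] = [set y ^ (g * h) | y in S].
Proof. by rewrite image_comp; congr image; apply/funext=> y /=; rewrite conjgM. Qed.

Lemma conj_setP (X : groupType) (S : set X) g x :
  [set h ^ g | h in S] x <-> S (x ^ g^-1).
Proof.
split=> [[h Sh <-]|Sx]; first by rewrite conjgK.
by exists (x ^ g^-1) => //; rewrite conjgKV.
Qed.

Section RootClass.
Variable C : groupType -> Prop.
Hypothesis hC : root_class C.

Definition separated (X : groupType) (Y : set X) (x : X) :=
  exists (K : groupType) (s : ghom X K), C K /\ forall y, Y y -> s y <> s x.

(** Surjectivity costs nothing, since the class is closed under subgroups. *)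
Lemma separableP (X : groupType) (Y : set X) :
  separable C Y <-> forall x, ~ Y x -> separated Y x.
Proof.
split=> hY x nYx.
  have [K [s [CK _ sx]]] := hY x nYx.
  by exists K; exists s; split=> // y Yy e; apply: sx; exists y.
have [K [s [CK sx]]] := hY x nYx.
have [L [j [j_inj jP]]] := subgroup_embedding (hom_image_subgroup s (setT_subgroup X)).
have im z : {y | j y = s z} by apply: cid; apply/jP; exists z.
pose r z := sval (im z); have rE z : j (r z) = s z by exact: svalP (im z).
have rM : {morph r : y z / y * z} by move=> y z; apply: j_inj; rewrite gmulfM !rE gmulfM.
exists L; exists (hom_of rM); split.
- exact: (root_class_subgroup hC j_inj).
- move=> k; have [|z _ zk] := (jP (j k)).2; first by exists k.
  by exists z; apply: j_inj; rewrite hom_ofE rE.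
- by case=> y Yy; rewrite !hom_ofE => e; apply: (sx y Yy); rewrite -!rE e.
Qed.

Lemma const_hom_mul (X Y : groupType) : {morph (fun=> 1) : x y / x * y : X >-> x * y : Y}.
Proof. by move=> x y; rewrite mulg1. Qed.

Definition triv_hom (X Y : groupType) : ghom X Y := hom_of (@const_hom_mul X Y).

(** The constant functions and the top group generate a direct product inside
    the wreath product. *)
Lemma joint_hom (X K L : groupType) (f : ghom X K) (g : ghom X L) :
  C K -> C L -> exists (M : groupType) (h : ghom X M), C M /\
    forall x y, h x = h y -> f x = f y /\ g x = g y.
Proof.
move=> CK CL.
have hM : {morph (fun x => ((fun=> f x, g x) : wreath K L)) : x y / x * y}.
  by move=> x y; rewrite !gmulfM.
exists (wreath K L); exists (hom_of hM); split; first exact: root_class_wreath.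
by move=> x y; rewrite !hom_ofE => -[/(congr1 (fun F => F 1))].
Qed.

Lemma residually_hom (X : groupType) x : residually C X -> x <> 1 ->
  exists (K : groupType) (s : ghom X K), C K /\ s x <> 1.
Proof.
move=> /separableP rX x1; have [K [s [CK sx]]] := rX x x1.
by exists K; exists s; split=> // e; apply: (sx 1) => //; rewrite gmulf1.
Qed.

Lemma separate_seq (X : groupType) (s : seq X) :
  (forall x, x \in s ->
    exists (K : groupType) (f : ghom X K), C K /\ f x <> 1) ->
  exists (K : groupType) (f : ghom X K),
    C K /\ forall x, x \in s -> f x <> 1.
Proof.
elim: s => [_|x s IH sep].
  have [K [_ [CK _]]] := root_class_nontrivial hC.
  by exists K; exists (triv_hom X K); split.
have [|K [f [CK fs]]] := IH; first by move=> y ys; apply: sep; rewrite inE ys orbT.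
have [|L [g [CL gx]]] := sep x; first by rewrite inE eqxx.
have [M [h [CM hP]]] := joint_hom f g CK CL.
exists M; exists h; split=> // y; rewrite inE => /orP[/eqP -> |/fs fy] h1.
  by apply: gx; rewrite -(@gmulf1 _ _ g); apply: (hP _ _ _).2; rewrite gmulf1.
by apply: fy; rewrite -(@gmulf1 _ _ f); apply: (hP _ _ _).1; rewrite gmulf1.
Qed.

End RootClass.

(** * Length functions of actions on trees *)

Definition powers (G : groupType) (c : G) : set G :=
  [set x | exists m, x = c ^+ m \/ x = c ^- m].

Lemma powersM (G : groupType) (c x : G) : powers c x -> powers c (c * x).
Proof.
case=> m [->|->]; first by exists m.+1; left; rewrite expgS.
case: m => [|m]; first by exists 1%N; left; rewrite invg1 mulg1.
by exists m; right; rewrite expgSr invgM mulVKg.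
Qed.

Lemma powersV (G : groupType) (c x : G) : powers c x -> powers c x^-1.
Proof. by case=> m [->|->]; exists m; [right|left]; rewrite ?invgK. Qed.

Lemma powers_commute (G : groupType) (c x y : G) :
  powers c x -> commute y c -> commute y x.
Proof. by case=> m [->|->] yc; [|apply: commuteV]; apply: commuteX. Qed.

(** The displacement of a base point with trivial stabiliser in an action on a
    tree: the last field is Gromov's four-point condition for the base point
    and its translates by [x], [y] and [z]. *)
Record tree_length (G : groupType) (L : G -> nat) : Prop := TreeLength {
  tree_length_eq1 : forall x, L x = 0%N <-> x = 1;
  tree_lengthV : forall x, L x^-1 = L x;
  tree_length4 : forall x y z,
    (L (x^-1 * y)%g + L z <=
      maxn (L (x^-1 * z)%g + L y) (L (z^-1 * y)%g + L x))%N
}.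

Section TreeLength.
Variables (G : groupType) (L : G -> nat).
Hypothesis hL : tree_length L.

Definition dist (x y : G) := L (x^-1 * y).

Lemma distMl g x y : dist (g * x) (g * y) = dist x y.
Proof. by rewrite /dist invgM -mulgA mulKg. Qed.

Lemma distC x y : dist x y = dist y x.
Proof. by rewrite /dist -(tree_lengthV hL) invgM invgK. Qed.

Lemma dist1 x : dist 1 x = L x.
Proof. by rewrite /dist invg1 mul1g. Qed.

Lemma dist_eq0 x y : dist x y = 0%N -> x = y.
Proof. by move/(tree_length_eq1 hL)/mulg1_eq; rewrite invgK. Qed.

Lemma distxx x : dist x x = 0%N.
Proof. by rewrite /dist mulVg; apply/(tree_length_eq1 hL). Qed.

Lemma dist4 a b x y :
  (dist a b + dist x y <= maxn (dist a x + dist b y) (dist a y + dist b x))%N.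
Proof.
have := tree_length4 hL (y^-1 * a) (y^-1 * b) (y^-1 * x).
rewrite -/(dist _ _) -/(dist (y^-1 * a) (y^-1 * x)) -/(dist (y^-1 * x) (y^-1 * b)).
rewrite !distMl -/(dist y x) -/(dist y a) -/(dist y b).
rewrite (distC y x) (distC y a) (distC y b) (distC x b); lia.
Qed.

Lemma dist3 x y z : (dist x z <= dist x y + dist y z)%N.
Proof. by have := dist4 x z y y; rewrite distxx (distC z y); lia. Qed.

Lemma distMr x z : dist x (x * z) = L z.
Proof. by rewrite /dist mulKg. Qed.

Lemma lenM x y : (L (x * y)%g <= L x + L y)%N.
Proof. by have := dist3 1 x (x * y); rewrite distMr !dist1. Qed.

Lemma len_conj x y : (L (x ^ y)%g <= L x + (L y).*2)%N.
Proof.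
rewrite conjE (leq_trans (lenM _ _)) // (tree_lengthV hL).
by have := lenM x y; lia.
Qed.

(** The base point lies on the axis of the hyperbolic isometry [h]. *)
Definition axial (h : G) := L (h * h) = (L h).*2 /\ (0 < L h)%N.

Lemma axialV h : axial h -> axial h^-1.
Proof. by rewrite /axial -invgM !(tree_lengthV hL). Qed.

Lemma axialX h N : axial h -> L (h ^+ N) = (N * L h)%N.
Proof.
case=> hh h0.
suff : L (h ^+ N) = (N * L h)%N /\ L (h ^+ N.+1) = (N.+1 * L h)%N by case.
elim: N => [|N [IH1 IH2]].
  by rewrite expg1 mul1n; split=> //; apply/(tree_length_eq1 hL).
split=> //.
have d1 : dist (h ^+ N) (h ^+ N.+1) = L h by rewrite (expgSr h N) distMr.
have d2 : dist (h ^+ N.+1) (h ^+ N.+2) = L h by rewrite (expgSr h N.+1) distMr.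
have d3 : dist (h ^+ N) (h ^+ N.+2) = (L h).*2.
  by rewrite (expgSr h N.+1) (expgSr h N) -mulgA distMr.
have := dist4 1 (h ^+ N.+1) (h ^+ N) (h ^+ N.+2).
have := dist3 1 (h ^+ N.+1) (h ^+ N.+2).
rewrite d3 d2 (distC (h ^+ N.+1) (h ^+ N)) d1 !dist1 IH1 IH2; lia.
Qed.

Lemma axial_dist h i j : axial h -> (i <= j)%N ->
  dist (h ^+ i) (h ^+ j) = ((j - i) * L h)%N.
Proof. by move=> ah ij; rewrite -{1}(subnKC ij) expgnDr distMr axialX. Qed.

Section Centralizer.
Variable h : G.
Hypothesis ah : axial h.

(** On the geodesic from the base point to the attracting end of [h]. *)
Definition forward x := exists N, (dist x (h ^+ N) + L x = N * L h)%N.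

Lemma dist_axis N : dist (h ^- N) (h ^+ N) = (N * L h).*2.
Proof. by rewrite /dist invgK -expgnDr axialX //; lia. Qed.

(** [x] moves both ends of a long segment of the axis by [L x], so it keeps the
    middle of this segment, and with it the base point, on the axis. *)
Lemma centralizer_axis x N : commute x h -> (4 * L x < N)%N ->
  (dist (h ^- N) x + dist x (h ^+ N) = (N * L h).*2)%N.
Proof.
move=> xh ltN; have h0 := ah.2.
have lt4 : (4 * L x < N * L h)%N by nia.
set P := h ^- N; set Q := h ^+ N.
have PQ : dist P Q = (N * L h).*2 := dist_axis N.
have xP : x * P = P * x by apply: commuteV; apply: commuteX.
have xQ : x * Q = Q * x by apply: commuteX.
have LQ : L Q = (N * L h)%N by exact: axialX.
have dPP : dist P (x * P) = L x by rewrite xP distMr.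
have dQQ : dist Q (x * Q) = L x by rewrite xQ distMr.
have dxP : dist x (x * P) = (N * L h)%N by rewrite distMr (tree_lengthV hL).
have dxQ : dist x (x * Q) = (N * L h)%N by rewrite distMr.
have dPQ : dist (x * P) (x * Q) = (N * L h).*2 by rewrite distMl.
have := dist4 P x (x * P) (x * Q); have := dist4 P (x * Q) Q x.
have := dist3 P x Q; have := dist3 P (x * Q) Q; have := dist3 P x (x * Q).
have := dist3 P (x * P) x; have := dist3 x (x * Q) Q.
have := dist3 (x * P) P (x * Q).
by rewrite (distC (x * P) P) (distC (x * Q) Q) (distC (x * Q) x) (distC Q x); lia.
Qed.

Lemma centralizer_forward x : commute x h -> forward x \/ forward x^-1.
Proof.
move=> xh; pose N := (4 * L x).+1.
have := centralizer_axis xh (ltnSn _ : (4 * L x < N)%N).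
have := dist4 (h ^- N) (h ^+ N) 1 x.
have := dist3 1 x (h ^+ N); have := dist3 (h ^- N) x 1.
have L1 : dist (h ^- N) 1 = (N * L h)%N.
  by rewrite distC dist1 (tree_lengthV hL) axialX.
have L2 : dist (h ^+ N) 1 = (N * L h)%N by rewrite distC dist1 axialX.
have L3 : dist x^-1 (h ^+ N) = dist (h ^- N) x.
  by rewrite /dist !invgK; congr L; apply: commuteX.
rewrite dist_axis L1 L2 !dist1 axialX // (distC x 1) dist1 (distC (h ^+ N) x).
move=> ? ? ? ?; have [?|?] : (dist x (h ^+ N) + L x = N * L h)%N \/
  (dist (h ^- N) x + L x = N * L h)%N by lia.
  by left; exists N.
by right; exists N; rewrite L3 (tree_lengthV hL).
Qed.

Lemma forward_le x M : forward x ->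
  exists2 N, (M <= N)%N & (dist x (h ^+ N) + L x = N * L h)%N.
Proof.
case=> N xN; exists (N + M)%N; first by lia.
have := dist3 x (h ^+ N) (h ^+ (N + M)); have := dist3 1 x (h ^+ (N + M)).
rewrite !dist1 axialX // (axial_dist ah (leq_addr M N)) addKn !mulnDl; lia.
Qed.

Lemma forward_dist x y : forward x -> forward y -> (L x <= L y)%N ->
  (dist x y + L x = L y)%N.
Proof.
move=> [N xN] fy xy; have [M leNM yM] := forward_le N fy.
have {}xM : (dist x (h ^+ M) + L x = M * L h)%N.
  have := dist3 x (h ^+ N) (h ^+ M); have := dist3 1 x (h ^+ M).
  rewrite !dist1 axialX // (axial_dist ah leNM) mulnBl;
  have := leq_mul2r (L h) N M; rewrite leNM orbT; lia.
have := dist4 1 (h ^+ M) x y; have := dist3 1 x y.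
by rewrite !dist1 axialX // (distC _ x) (distC (h ^+ M) y); lia.
Qed.

(** In the centralizer, lengths of forward elements add up, so an element of
    least positive length generates. *)
Lemma centralizer_cyclic : exists c,
  [/\ axial c, powers c h & forall x, commute x h -> powers c x].
Proof.
pose cent n := `[< exists x, [/\ commute x h, x <> 1 & L x = n] >].
have ex_cent : exists n, cent n.
  exists (L h); apply/asboolP; exists h; split=> // h1; have := ah.2.
  by rewrite (tree_length_eq1 hL h).2.
have [c [fc ch c1 c_min]] : exists c, [/\ forward c, commute c h, c <> 1 &
    forall x, commute x h -> x <> 1 -> (L c <= L x)%N].
  case: (ex_minnP ex_cent) => n /asboolP[c [ch c1 Lc]] n_min.
  have c_min x : commute x h -> x <> 1 -> (L c <= L x)%N.
    by move=> xh x1; rewrite Lc; apply/n_min/asboolP; exists x.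
  case: (centralizer_forward ch) => fc; first by exists c.
  exists c^-1; split=> //; last by move=> x; rewrite (tree_lengthV hL); apply: c_min.
    by apply/commute_sym/commuteV/commute_sym.
  by move/eqP; rewrite invg_eq1 => /eqP.
have Lc0 : (0 < L c)%N by rewrite lt0n; apply/eqP => /(tree_length_eq1 hL).
have centP x : commute x h -> powers c x.
  have [n] := ubnP (L x); elim: n x => // n IH x ltn xh.
  have [->|x1] := pselect (x = 1); first by exists 0%N; left.
  wlog fx : x ltn xh x1 / forward x.
    move=> wl; case: (centralizer_forward xh) => fx; first exact: wl.
    rewrite -[x]invgK; apply: powersV; apply: wl => //.
    - by rewrite (tree_lengthV hL).
    - exact/commute_sym/commuteV/commute_sym.
    - by move/eqP; rewrite invg_eq1 => /eqP.
  have := forward_dist fc fx (c_min x xh x1); rewrite /dist => Lcx.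
  suff : powers c (c^-1 * x) by move/powersM; rewrite mulVKg.
  apply: IH; first by lia.
  apply: commute_sym; apply: commuteM; last exact: commute_sym.
  by apply: commuteV; apply: commute_sym.
exists c; split; [|exact: centP|exact: centP].
split=> //; have [N cN] := fc.
have d1 : dist (h ^- N) c^-1 = dist c (h ^+ N).
  rewrite /dist invgK; congr L.
  exact/commuteV/commute_sym/commuteX.
have d2 : dist c^-1 c = L (c * c) by rewrite /dist invgK.
have := dist3 (h ^- N) c^-1 (h ^+ N); have := dist3 c^-1 c (h ^+ N).
have := dist3 1 c (c * c).
rewrite dist_axis d1 d2 distMr !dist1; lia.
Qed.

End Centralizer.

(** If long initial segments of the orbits of two hyperbolic isometries of the
    same translation length stay close, then the axes share a segment longer
    than the translation length, along which the isometries agree; stabilisers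
    being trivial, the isometries coincide. *)
Lemma axes_overlap h k y N : axial h -> axial k -> L h = L k ->
  (8 * L y + 10 < N)%N ->
  (dist (h ^+ N) ((k ^ y)%g ^+ N) <= N * L h + (L y).*2)%N -> h = k ^ y.
Proof.
move=> ah ak hk ltN closeN; set g := k ^ y.
pose q j := y^-1 * k ^+ j; pose i := (L y).+1.
have h0 := ah.2.
have qg j : dist (q j) (g ^+ j) = L y.
  by rewrite /g -conjXg conjE mulgA distMr.
have gq j : g * q j = q j.+1.
  by rewrite /g /q conjE -!mulgA mulVKg expgS.
have dq0 : dist 1 (q 0%N) = L y by rewrite dist1 /q mulg1 (tree_lengthV hL).
have dqN : dist (q 0%N) (q N) = (N * L h)%N.
  by rewrite /q distMl expg0 dist1 axialX // hk.
have dqNS : dist (q N) (q N.+1) = L h by rewrite /q distMl expgSr distMr hk.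
have dq0NS : dist (q 0%N) (q N.+1) = (N.+1 * L h)%N.
  by rewrite /q distMl expg0 dist1 axialX // hk.
have dq1 : dist (q 0%N) (q 1%N) = L h by rewrite /q distMl expg0 dist1 expg1 hk.
(* [i] is large enough for [h ^+ i] to be on the axis of [g], past the bridge
   from the base point, and [N] for [h ^+ i.+1] to be on the common part. *)
have on j : (L y < j)%N -> (j <= i.+1)%N ->
    dist (q 0%N) (h ^+ j) + dist (h ^+ j) (q N) = (N * L h)%N /\
    dist (h ^+ j) (q N) + j * L h = dist 1 (q N).
  move=> ltj leji.
  have hjN : dist (h ^+ j) (h ^+ N) + j * L h = (N * L h)%N.
    have jN : (j <= N)%N by rewrite /i in leji; lia.
    by rewrite axial_dist //; nia.
  have b1 : (2 * (j * L h) + 4 * L y < N * L h)%N by rewrite /i in leji; nia.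
  have b2 : (L y < j * L h)%N by nia.
  have hj : dist 1 (h ^+ j) = (j * L h)%N by rewrite dist1 axialX.
  have hN : dist 1 (h ^+ N) = (N * L h)%N by rewrite dist1 axialX.
  have := dist4 (h ^+ j) (q N) 1 (h ^+ N).
  have := dist4 1 (q N) (q 0%N) (h ^+ j).
  have := dist3 1 (q 0%N) (q N); have := dist3 (q 0%N) 1 (q N).
  have := dist3 (h ^+ N) (g ^+ N) (q N); have := qg N.
  have := dist3 1 (h ^+ j) (q N); have := dist3 (q 0%N) (h ^+ j) (q N).
  have := dist3 1 (q 0%N) (h ^+ j).
  rewrite (distC (g ^+ N)) (distC (h ^+ j) 1) (distC (q N) 1) (distC (q N) (h ^+ N)).
  rewrite (distC (q N) (h ^+ j)) (distC (q N) (q 0%N)) (distC (q 0%N) 1).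
  by rewrite -/g in closeN; lia.
have [o1 p1] := on i (ltnSn _) (leqnSn _).
have [o2 p2] := on i.+1 (ltnW (ltnSn _)) (leqnn _).
have gi1 : dist (q 1%N) (g * h ^+ i) = dist (q 0%N) (h ^+ i) by rewrite -gq distMl.
have gi2 : dist (g * h ^+ i) (q N.+1) = dist (h ^+ i) (q N) by rewrite -gq distMl.
have e : h ^+ i.+1 = g * h ^+ i.
  apply: dist_eq0.
  have := dist4 (q 0%N) (q N.+1) (h ^+ i.+1) (g * h ^+ i).
  have := dist3 (q 0%N) (q 1%N) (g * h ^+ i).
  have := dist3 (h ^+ i.+1) (q N) (q N.+1).
  rewrite (distC (q N.+1)) (distC (q N.+1) (h ^+ i.+1)); nia.
by apply: (@mulIg _ (h ^+ i)); rewrite -(expgS h i).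
Qed.

End TreeLength.

(** * Ping-pong and identities *)

Definition letter (K : groupType) (a b : K) (l : bool * bool) : K :=
  let g := if l.1 then a else b in if l.2 then g^-1 else g.

Definition eval (K : groupType) (a b : K) (W : seq (bool * bool)) : K :=
  foldr (fun l g => letter a b l * g) 1 W.

Definition inv_letter (l : bool * bool) := (l.1, ~~ l.2).

Definition freely_reduced := sorted (fun l m : bool * bool => m != inv_letter l).

Lemma letterV (K : groupType) (a b : K) l : letter a b (inv_letter l) = (letter a b l)^-1.
Proof. by case: l => [[] []]; rewrite /letter //= invgK. Qed.

Lemma eval_cat (K : groupType) (a b : K) U W :
  eval a b (U ++ W) = eval a b U * eval a b W.
Proof. by elim: U => [|l U IH] /=; rewrite ?mul1g // IH mulgA. Qed.

Lemma eval_inv (K : groupType) (a b : K) W :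
  eval a b (rev (map inv_letter W)) = (eval a b W)^-1.
Proof.
elim: W => [|l W IH] /=; first by rewrite invg1.
by rewrite rev_cons -cats1 eval_cat IH /= mulg1 letterV invgM.
Qed.

Lemma eval_nseq (K : groupType) (a b : K) l n :
  eval a b (nseq n l) = letter a b l ^+ n.
Proof. by elim: n => [|n IH] //=; rewrite IH expgS. Qed.

Lemma free_reduction W : exists2 W', freely_reduced W' &
  forall (K : groupType) (a b : K), eval a b W' = eval a b W.
Proof.
elim: W => [|l W [W' rW' eW']]; first by exists [::].
case: W' rW' eW' => [|m W'] rW' eW'.
  by exists [:: l] => // K a b; rewrite /= -eW'.
have [ml|ml] := eqVneq m (inv_letter l); last first.
  by exists [:: l, m & W']; [rewrite /= ml|move=> K a b; rewrite /= -eW'].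
exists W'; first exact: path_sorted rW'.
by move=> K a b; rewrite /= -eW' /= ml letterV mulVKg.
Qed.

Section PingPong.
Variables (G : groupType) (L : G -> nat).
Hypothesis hL : tree_length L.
Variables a b : G.

(** The segments from the base point to its images under two letters separate
    before the midpoint of the shorter one. *)
Definition spread := forall l m, l <> m ->
  (maxn (L (letter a b l)) (L (letter a b m)) <
   dist L (letter a b l) (letter a b m))%N.

(** Ping-pong on the sets of points that are at least as close to [letter l] as
    to the base point; by the four-point condition they are disjoint. *)
Lemma ping_pong W : spread -> freely_reduced W -> W <> [::] -> eval a b W <> 1.
Proof.
move=> sp.
have L1 : L 1 = 0%N by apply/(tree_length_eq1 hL).
have pos l : (0 < L (letter a b l))%N.
  have := sp l (inv_letter l); rewrite letterV (tree_lengthV hL) maxnn.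
  rewrite lt0n => h; apply/negP => /eqP l0; move: h; rewrite l0.
  rewrite ((tree_length_eq1 hL _).1 l0) invg1 (distxx hL) ltnn.
  by move=> h; suff : false by []; apply: h; case: (l) => ? [].
pose near l x := (dist L (letter a b l) x <= L x)%N.
have disj l m x : near l x -> near m x -> l = m.
  move=> nl nm; apply: contrapT => /sp.
  have := dist4 hL (letter a b l) (letter a b m) 1 x.
  rewrite !(distC hL _ 1) !(dist1 L); move: nl nm; rewrite /near; lia.
have near1 l : ~ near l 1.
  by rewrite /near (distC hL) (dist1 L) L1 leqNgt pos.
have nearW l W' : freely_reduced (l :: W') -> near l (eval a b (l :: W')).
  elim: W' l => [|m W' IH] l.
    by rewrite /near /= mulg1 (distxx hL).
  rewrite /freely_reduced /= => /andP[ml rW]; have {IH} := IH m rW.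
  rewrite -[letter a b m * _]/(eval a b (m :: W')); move: (eval _ _ _) => x mx.
  have nlx : ~ near (inv_letter l) x by move=> /(disj _ _ _ mx)/eqP; apply/negP.
  rewrite /near /dist mulKg; move: nlx => /negP.
  by rewrite /near /dist letterV invgK -ltnNge => /ltnW.
move=> rW W0 W1; case: W rW W0 W1 => // l W' rW _ W1.
by apply: (near1 l); rewrite -W1; apply: nearW.
Qed.

(** By [ping_pong], a word that vanishes at [a] and [b] freely reduces to the empty
    one. *)
Lemma spread_free W (K : groupType) (a' b' : K) :
  spread -> eval a b W = 1 -> eval a' b' W = 1.
Proof.
move=> sp; have [W' rW' eW'] := free_reduction W; rewrite -!eW' => W'1.
case: W' {eW'} rW' W'1 => // l W' rW' W'1.
by case: (ping_pong sp rW' _ W'1).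
Qed.

End PingPong.

(** The translates of the base point by [h ^+ N] and [(h ^ y) ^+ N] are too far
    apart for [axes_overlap] to apply, for each choice of the signs. *)
Lemma spread_conj (G : groupType) (L : G -> nat) (h y : G) :
  tree_length L -> axial L h -> h ^ y <> h -> h ^ y <> h^-1 ->
  exists2 N, (0 < N)%N & spread L (h ^+ N) ((h ^ y) ^+ N).
Proof.
move=> hL ah gh ghV; set g := h ^ y.
pose N := (8 * L y + 11)%N; exists N; first by rewrite /N; lia.
have h0 := ah.2.
have Ny : (4 * L y < N * L h)%N by rewrite /N; nia.
have Lh : L (h ^+ N) = (N * L h)%N by exact: axialX.
have hh : dist L (h ^+ N) (h ^- N) = (N * L h).*2.
  by rewrite (distC hL) (dist_axis hL ah).
have Lconj z : (L (h ^+ z) <= L (g ^+ z) + (L y).*2)%N /\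
    (L (g ^+ z) <= L (h ^+ z) + (L y).*2)%N.
  rewrite /g -conjXg; split; last exact: len_conj.
  by have := len_conj hL (h ^+ z ^ y) y^-1; rewrite conjgK (tree_lengthV hL).
have [g1 g2] := Lconj N.
have gg : (L (g ^+ N) < dist L (g ^+ N) (g ^- N))%N.
  have [g3 _] := Lconj (N + N)%N.
  have -> : dist L (g ^+ N) (g ^- N) = L (g ^+ (N + N)).
    by rewrite (distC hL) /dist invgK -expgnDr.
  by have := axialX hL (N + N) ah; lia.
have far h1 h2 : h1 = h \/ h1 = h^-1 -> h2 = h \/ h2 = h^-1 ->
   (N * L h + (L y).*2 < dist L (h1 ^+ N) ((h2 ^ y)%g ^+ N))%N.
  move=> e1 e2; rewrite ltnNge; apply/negP => near.
  have ax k : k = h \/ k = h^-1 -> axial L k /\ L k = L h.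
    by case=> ->; split=> //; [exact: axialV|exact: tree_lengthV].
  have [[a1 l1] [a2 l2]] := (ax h1 e1, ax h2 e2).
  have := axes_overlap hL a1 a2 (N := N) (y := y).
  rewrite l1 l2 => /(_ erefl _ near) e.
  have {}e : h1 = h2 ^ y by apply: e; rewrite /N; lia.
  case: e1 e2 e => -> [] ->; rewrite ?conjVg.
  - by move/esym/gh.
  - by move/esym/(canRL (@invgK G))/ghV.
  - by move/esym/ghV.
  - by move/invg_inj/esym/gh.
set a := h ^+ N in Lh hh g1 g2 *; set b := g ^+ N in g1 g2 gg *.
have f1 : (N * L h + (L y).*2 < dist L a b)%N by apply: far; left.
have f2 : (N * L h + (L y).*2 < dist L a b^-1)%N.
  by have := far h h^-1; rewrite conjVg expVgn; apply; [left|right].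
have f3 : (N * L h + (L y).*2 < dist L a^-1 b)%N.
  by have := far h^-1 h; rewrite expVgn; apply; [right|left].
have f4 : (N * L h + (L y).*2 < dist L a^-1 b^-1)%N.
  by have := far h^-1 h^-1; rewrite conjVg !expVgn; apply; right.
have La : L a^-1 = L a := tree_lengthV hL a.
have Lb : L b^-1 = L b := tree_lengthV hL b.
have c0 := distC hL b^-1 b; have c1 := distC hL a^-1 a.
have c2 := distC hL b a; have c3 := distC hL b^-1 a.
have c4 := distC hL b a^-1; have c5 := distC hL b^-1 a^-1.
by move=> [[] []] [[] []] //; rewrite /letter /= => _; lia.
Qed.

Lemma free_basis_ind (F : groupType) k (x : 'I_k -> F) (S : set F) :
  free_basis x -> is_subgroup S -> (forall i, S (x i)) -> forall v, S v.
Proof.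
move=> fx hS Sx v.
have [Y [j [_ jP]]] := subgroup_embedding hS.
have im i : {y | j y = x i} by apply: cid; apply/jP.
have [f [fE _]] := fx Y (fun i => sval (im i)).
have [h [_ hP]] := fx F x.
apply/jP; exists (f v); rewrite -[RHS]/(idfun v).
rewrite (hP idfun) // -[LHS]/((j \o f) v) (hP (j \o f)) // => i /=.
by rewrite fE (svalP (im i)).
Qed.

Lemma free_basis_words (F K1 K2 : groupType) k (x : 'I_k -> F) (f1 : ghom F K1)
    (f2 : ghom F K2) (a1 b1 : K1) (a2 b2 : K2) :
  free_basis x ->
  (forall i, f1 (x i) = b1 ^ (a1 ^- i)) -> (forall i, f2 (x i) = b2 ^ (a2 ^- i)) ->
  forall v, exists W, eval a1 b1 W = f1 v /\ eval a2 b2 W = f2 v.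
Proof.
move=> fx f1x f2x; apply: free_basis_ind fx _ _ => [|i].
  apply: subgroupI => /=.
  - by exists [::]; rewrite !gmulf1.
  - move=> v w [V [V1 V2]] [W [W1 W2]]; exists (V ++ W).
    by rewrite !eval_cat !gmulfM V1 V2 W1 W2.
  - move=> v [V [V1 V2]]; exists (rev (map inv_letter V)).
    by rewrite !eval_inv !gmulfV V1 V2.
exists (nseq i (true, false) ++ (false, false) :: nseq i (true, true)).
by rewrite !eval_cat /= !eval_nseq /letter /= f1x f2x !conjE !invgK !expVgn.
Qed.

(** The conjugates of [b'] by the powers of [a'] are elements of the base group
    whose coordinates at 1 are the basis elements. *)
Lemma free_basis_wreath (F G : groupType) k (x : 'I_k -> F) (a : G) :
  free_basis x -> (forall i j : 'I_k, a ^+ i = a ^+ j -> i = j) ->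
  exists (Psi : ghom F (wreath F G)) (a' b' : wreath F G),
    (forall i, Psi (x i) = b' ^ (a' ^- i)) /\ forall v, Psi v = 1 -> v = 1.
Proof.
move=> fx a_inj.
pose f (p : G) : F := if [pick i : 'I_k | p == a ^+ i] is Some i then x i else 1.
pose a' : wreath F G := (fun=> 1, a); pose b' : wreath F G := (f, 1).
have [Psi [Psix _]] := fx _ (fun i : 'I_k => b' ^ (a' ^- i)).
exists Psi; exists a'; exists b'; split=> // v.
have aX n : a' ^+ n = ((fun=> 1, a ^+ n) : wreath F G).
  elim: n => [//|n IH]; rewrite expgS IH expgS; congr pair.
  by apply/funext=> p /=; rewrite mulg1.
suff [_ vE] : (Psi v).2 = 1 /\ (Psi v).1 1 = v by move=> v1; rewrite -vE v1.
move: v; apply: free_basis_ind fx _ _ => [|i] /=.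
  apply: subgroupI => /=.
  - by rewrite gmulf1.
  - by move=> v w [v2 v1] [w2 w1]; rewrite gmulfM /= v2 v1 w2 !mul1g w1.
  - by move=> v [v2 v1]; rewrite gmulfV /= v2 invg1 mul1g v1.
rewrite Psix conjE invgK aX /= !mul1g mulgV; split=> //.
rewrite invg1 mulg1 /f; case: pickP => [j /eqP /a_inj -> //|/(_ i)].
by rewrite eqxx.
Qed.

(** Otherwise powers [a] of [h] and [b] of [h ^ y] play ping-pong; the conjugates
    of [b] by the powers of [a] then satisfy no relation, as they satisfy none
    in the wreath product of [free_basis_wreath]. *)
Lemma identity_axis (G : groupType) (L : G -> nat) (H : set G) (h y : G) :
  tree_length L -> is_subgroup H -> satisfies_nontrivial_identity H ->
  axial L h -> H h -> H y -> h ^ y = h \/ h ^ y = h^-1.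
Proof.
move=> hL hH [F [k [x [w [fx w1 law]]]]] ah Hh Hy.
apply: contrapT => /not_orP[gh ghV].
have [N N0 sp] := spread_conj hL ah gh ghV.
set a := h ^+ N in sp; set b := (h ^ y) ^+ N in sp.
have Ha : H a by exact: subgroupX.
have Hb : H b.
  apply: subgroupX => //; rewrite conjE; apply: subgroupM => //; first exact: subgroupV.
  exact: subgroupM.
have [i j|Psi [a' [b' [Psix Psi_inj]]]] := @free_basis_wreath F G k x a fx.
  move=> /(congr1 L); rewrite /a -!expgnA !axialX // => /eqP.
  by rewrite eqn_pmul2r ?ah.2 // eqn_pmul2l // => /eqP/val_inj.
have [phi [phix _]] := fx G (fun i : 'I_k => b ^ (a ^- i)).
have [W [W1 W2]] := free_basis_words fx phix Psix w.
apply/w1/Psi_inj; rewrite -W2; apply: spread_free hL _ _ _ _ _ _ sp _.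
rewrite W1; apply: law => i; rewrite phix conjE invgK.
apply: subgroupM => //; first exact: subgroupX.
by apply: subgroupM => //; apply: subgroupV => //; apply: subgroupX.
Qed.

(** * Words in a free product *)

Section FreeProduct.
Variables (I : Type) (A : I -> groupType) (G : groupType).
Variable iota : forall i, ghom (A i) G.
Hypothesis hG : is_free_product iota.

Lemma free_product_hom_eq (K : groupType) (f g : ghom G K) :
  (forall i a, f (iota i a) = g (iota i a)) -> f =1 g.
Proof.
move=> fg; have [h [_ hP]] := hG (fun i => (f \o iota i : ghom (A i) K)).
by move=> x; rewrite (hP f) // (hP g) // => i a /=; rewrite fg.
Qed.

(** The homomorphism given by the universal property lands in [S], and followed
    by the inclusion it is the identity. *)
Lemma free_product_ind (S : set G) : is_subgroup S ->
  (forall i a, S (iota i a)) -> forall x, S x.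
Proof.
move=> hS Siota x.
have [Y [j [j_inj jP]]] := subgroup_embedding hS.
have im i a : {y | j y = iota i a} by apply: cid; apply/jP.
pose r i a := sval (im i a); have rE i a : j (r i a) = iota i a by exact: svalP (im i a).
have rM i : {morph r i : a b / a * b}.
  by move=> a b; apply: j_inj; rewrite gmulfM !rE gmulfM.
have [f [fE _]] := hG (fun i => hom_of (rM i)).
have jf : j \o f =1 idfun.
  by apply: (@free_product_hom_eq _ (j \o f) idfun) => i a /=; rewrite fE hom_ofE rE.
by apply/jP; exists (f x); exact: jf.
Qed.

Lemma retraction i : exists r : ghom G (A i), (forall a, r (iota i a) = a) /\
  forall j a, j <> i -> r (iota j a) = 1.
Proof.
pose f j : ghom (A j) (A i) :=
  match pselect (j = i) with
  | left e => match e in _ = k return ghom (A j) (A k) with erefl => idfun end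
  | right _ => triv_hom (A j) (A i)
  end.
have [r [rE _]] := hG f; exists r; split=> [a|j a ji]; rewrite rE /f.
  by case: pselect => // e; rewrite (Prop_irrelevance e erefl).
by case: pselect.
Qed.

Lemma iota_inj i : injective (iota i).
Proof. by have [r [rK _]] := retraction i; apply: can_inj rK. Qed.

Definition free_factor i : set G := range (iota i).

Lemma factor_subgroup i : is_subgroup (free_factor i).
Proof. exact/hom_image_subgroup/setT_subgroup. Qed.

Implicit Types (w u v : seq (I * G)) (x y s : I * G).

Definition wval w : G := foldr (fun x g => x.2 * g) 1 w.

Definition infactor x := `[< free_factor x.1 x.2 >].
Definition syllable x := infactor x && (x.2 != 1).
Definition differ x y := ~~ `[< x.1 = y.1 >].
Definition reduced w := all syllable w && sorted differ w.

Lemma differP x y : reflect (x.1 <> y.1) (differ x y).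
Proof. by apply: (iffP negP) => h e; apply: h; apply/asboolP. Qed.

Lemma differC x y : differ x y = differ y x.
Proof. by apply/differP/differP => /nesym. Qed.

Lemma wval_cat u v : wval (u ++ v) = wval u * wval v.
Proof. by elim: u => [|x u IH] /=; rewrite ?mul1g // IH mulgA. Qed.

Lemma wval_rcons u x : wval (rcons u x) = wval u * x.2.
Proof. by rewrite -cats1 wval_cat /= mulg1. Qed.

Section EdgeLift.
Variables (K T : groupType) (k : ghom G K) (t : T) (i1 : I).

Definition edge i (p : K) : T := if `[< i = i1 >] && (p == 1) then t else 1.

Lemma edge_hom_mul i : {morph (fun a =>
  ((fun p => (edge i p)^-1 * edge i (p * k (iota i a)), k (iota i a))
    : wreath T K)) : a b / a * b}.
Proof.
move=> a b; rewrite !gmulfM; congr pair; apply/funext=> p /=.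
by rewrite !mulgA mulgK.
Qed.

(** [Phi] is [k] followed by the embedding of [K] in the wreath product,
    conjugated on the i-th factor by the function [edge i].  The coordinate at
    [p] of the image of a word multiplies the labels along the path that the
    word traces in [K] from [p].  The only label [t] is met at the start, when
    [p = 1], since the path does not return to 1 except possibly at its end,
    through a factor other than [i1]. *)
Lemma edge_lift : exists Phi : ghom G (wreath T K),
  (forall g, (Phi g).2 = k g) /\
  forall x w p, all infactor (x :: w) -> x.1 = i1 -> differ x (last x w) ->
  (forall u v, x :: w = u ++ v -> u <> [::] -> v <> [::] ->
     p * k (wval u) <> 1) ->
  (Phi (wval (x :: w))).1 p = if p == 1 then t^-1 else 1.
Proof.
have [Phi [PhiE _]] := hG (fun i => hom_of (@edge_hom_mul i)).
have sndM : {morph (fun g => (Phi g).2) : g h / g * h}.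
  by move=> g h; rewrite gmulfM.
have Phi2 g : (Phi g).2 = k g.
  by apply: (@free_product_hom_eq _ (hom_of sndM) k) => i a; rewrite hom_ofE PhiE.
exists Phi; split=> // x w p.
have PhiM g h q : (Phi (g * h)).1 q = (Phi g).1 q * (Phi h).1 (q * k g).
  by rewrite gmulfM -Phi2.
have PhiF s q : infactor s ->
    (Phi s.2).1 q = (edge s.1 q)^-1 * edge s.1 (q * k s.2).
  by case: s => i z /asboolP [a _ /= <-]; rewrite PhiE.
have path1 v q : all infactor v ->
    (forall u1 s u2, v = u1 ++ s :: u2 ->
       edge s.1 (q * k (wval u1)) = 1 /\ edge s.1 (q * k (wval u1) * k s.2) = 1) ->
    (Phi (wval v)).1 q = 1.
  elim: v q => [|s v IH] q /=; first by rewrite gmulf1.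
  case/andP=> sF vF h; rewrite PhiM PhiF //.
  have [] := h [::] s v erefl; rewrite /= gmulf1 mulg1 => -> ->.
  rewrite invg1 !mul1g; apply: IH => // u1 s' u2 e.
  by have := h (s :: u1) s' u2; rewrite /= e gmulfM mulgA; apply.
move=> /= /andP[xF wF] x1 xlast avoid.
have w0 : w <> [::] by move=> w0; move: xlast; rewrite w0 => /differP.
have edge1 i q : q <> 1 -> edge i q = 1.
  by move=> /eqP/negPf q1; rewrite /edge q1 andbF.
rewrite PhiM PhiF // [edge _ (p * _)]edge1; last first.
  by have := avoid [:: x] w; rewrite /= mulg1; apply.
rewrite path1 ?mulg1 //; last first.
  move=> u1 s u2 e; split.
    rewrite edge1 //; have := avoid (x :: u1) (s :: u2).
    by rewrite /= e gmulfM mulgA; apply.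
  case: u2 e => [|s' u2] e.
    rewrite /edge; case: asboolP => //= s1; move/differP: xlast; case.
    by rewrite e last_cat /= s1.
  rewrite edge1 //; have := avoid (x :: rcons u1 s) (s' :: u2).
  by rewrite /= e cat_rcons wval_rcons !gmulfM !mulgA; apply.
rewrite /edge x1; have -> : `[< i1 = i1 >] by apply/asboolP.
by rewrite /=; case: eqP; rewrite ?invg1.
Qed.

End EdgeLift.

Lemma reduced_cons x w : reduced (x :: w) =
  [&& syllable x, (if w is y :: _ then differ x y else true) & reduced w].
Proof.
rewrite /reduced; case: w => [|y w] /=; first by rewrite !andbT.
by case: (syllable x); case: (differ x y); rewrite /= ?andbF.
Qed.

Lemma reduced_rcons x w : reduced (rcons w x) -> reduced w.
Proof.
rewrite /reduced all_rcons => /andP[/andP[_ ->]] /=.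
by case: w => // y w /=; rewrite rcons_path => /andP[].
Qed.

Lemma reduced_infactor w : reduced w -> all infactor w.
Proof. by case/andP=> h _; apply: sub_all h => x /andP[]. Qed.

Lemma reduced_catl u v : reduced (u ++ v) -> reduced u.
Proof.
elim/last_ind: v u => [|v x IH] u; first by rewrite cats0.
by rewrite -rcons_cat => /reduced_rcons/IH.
Qed.

Lemma reduced_differ_rcons w y i z : reduced (rcons w y) -> y.1 = i ->
  free_factor i z -> z <> 1 -> reduced (rcons w (i, z)).
Proof.
rewrite /reduced !all_rcons => /andP[/andP[_ ->] /= sw] <- zF z1; rewrite andbT.
apply/andP; split; first by apply/andP; split; [apply/asboolP|apply/eqP].
by case: w sw => //= s w; rewrite !rcons_path.
Qed.

(** As long as the extreme syllables share a factor, conjugation by the first of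
    them merges the two. *)
Lemma cyclic_reduction w : reduced w -> w <> [::] ->
  exists g x v, [/\ reduced (x :: v), wval (x :: v) = wval w ^ g,
    (size (x :: v) <= size w)%N & v = [::] \/ differ x (last x v)].
Proof.
have [n] := ubnP (size w); elim: n w => // n IH [//|x w] /= sw rw _.
case/lastP: w sw rw => [|w y] sw rw.
  by exists 1, x, [::]; split=> //; [rewrite conjg1|left].
have [xy|/differP xy] := pselect (x.1 = y.1); last first.
  by exists 1, x, (rcons w y); rewrite conjg1 last_rcons; split=> //; right.
have := rw; rewrite -rcons_cons => /reduced_infactor; rewrite all_rcons /=.
case/and3P=> /asboolP yF /asboolP xF _.
have conj : wval (x :: rcons w y) ^ x.2 = wval w * (y.2 * x.2).
  by rewrite /= wval_rcons conjE !mulgA mulVg mul1g.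
move: rw; rewrite reduced_cons => /and3P[_ xw rw].
have w0 : w <> [::] by move=> w0; move: xw; rewrite w0 => /differP.
rewrite size_rcons in sw *.
have [yx1|yx1] := pselect (y.2 * x.2 = 1).
  have [|//|g [z [v [rv vE sv zv]]]] := IH w _ (reduced_rcons rw); first by lia.
  exists (x.2 * g), z, v; split=> //; last by move: sv => /=; lia.
  by rewrite [LHS]vE conjgM conj yx1 mulg1.
have [||//|g [z [v [rv vE sv zv]]]] := IH (rcons w (y.1, y.2 * x.2)).
- by rewrite size_rcons.
- apply: reduced_differ_rcons rw _ _ _ => //.
  by apply: subgroupM => //; [exact: factor_subgroup|rewrite -xy].
- by case: (w).
exists (x.2 * g), z, v; split=> //; last by move: sv; rewrite size_rcons /=; lia.
by rewrite [LHS]vE conjgM conj wval_rcons.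
Qed.

Section Residual.
Variable C : groupType -> Prop.
Hypotheses (hC : root_class C) (hA : forall i, residually C (A i)).

(** Induction on the length of a word, which may be taken cyclically reduced.
    If its proper nonempty prefixes survive in some [K] of the class, then the
    path that it traces in [K] crosses the edge on which [edge] is supported
    exactly once. *)
Lemma reduced_separated w : reduced w -> w <> [::] ->
  exists (K : groupType) (f : ghom G K), C K /\ f (wval w) <> 1.
Proof.
have [n] := ubnP (size w); elim: n w => // n IH w0 sw0 rw0 w00.
have [g [x [w [rw ww sw xw]]]] := cyclic_reduction rw0 w00.
suff [K [f [CK fw]]] : exists (K : groupType) (f : ghom G K),
    C K /\ f (wval (x :: w)) <> 1.
  by exists K; exists f; split=> // e; apply: fw; rewrite ww gmulfJ e conj1g.
case: xw => [w1|xw].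
  move: rw; rewrite w1 reduced_cons => /and3P[/andP[/asboolP [a _ ax] x1] _ _].
  have [r [rK _]] := retraction x.1.
  have [|K [s [CK sa]]] := residually_hom hC (@hA x.1) (x := a).
    by move=> a1; move: x1; rewrite -ax a1 gmulf1 eqxx.
  by exists K; exists (s \o r); split=> //=; rewrite mulg1 -ax rK.
set s := [seq wval (take j (x :: w)) | j <- seq.iota 1 (size w)].
have [|K [k [CK ks]]] := separate_seq hC (s := s).
  move=> z /mapP[j]; rewrite mem_iota => j_lt ->; apply: IH.
  - by rewrite size_take; move: sw => /=; case: ifP; lia.
  - by apply: (@reduced_catl _ (drop j (x :: w))); rewrite cat_take_drop.
  - by case: j j_lt.
have [T [t [CT t1]]] := root_class_nontrivial hC.
have [Phi [_ PhiP]] := edge_lift k t x.1.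
exists (wreath T K); exists Phi; split; first exact: root_class_wreath.
move/(congr1 (fun F : wreath T K => F.1 1)).
rewrite PhiP ?(reduced_infactor rw) //.
  by rewrite eqxx => /eqP; rewrite invg_eq1 => /eqP.
move=> u v e u0 v0; rewrite mul1g; apply: ks; apply/mapP; exists (size u).
  rewrite mem_iota; move/(congr1 size): e; rewrite /= size_cat.
  by case: (u) (v) u0 v0 => // ? ? [] //= *; lia.
by rewrite e take_size_cat.
Qed.

Lemma reduced_wval1 w : reduced w -> wval w = 1 -> w = [::].
Proof.
move=> rw w1; apply: contrapT => w0.
by have [K [f [_ []]]] := reduced_separated rw w0; rewrite w1 gmulf1.
Qed.

Lemma reduced_mul i z w : free_factor i z -> reduced w ->
  exists2 v, reduced v & wval v = z * wval w.
Proof.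
move=> zF rw; have [->|z1] := pselect (z = 1); first by exists w; rewrite ?mul1g.
have sz : syllable (i, z) by apply/andP; split; [apply/asboolP|apply/eqP].
case: w rw => [|y v] rw; first by exists [:: (i, z)]; rewrite // /reduced /= sz.
have [iy|/differP iy] := pselect ((i, z).1 = y.1); last first.
  by exists ((i, z) :: y :: v) => //; rewrite reduced_cons sz iy.
move: rw; rewrite reduced_cons => /and3P[/andP[/asboolP yF _] yv rv].
have [zy1|zy1] := pselect (z * y.2 = 1); first by exists v; rewrite //= mulgA zy1 mul1g.
exists ((i, z * y.2) :: v); last by rewrite /= mulgA.
rewrite reduced_cons rv andbT; apply/andP; split.
  apply/andP; split; last exact/eqP.
  apply/asboolP; rewrite /=; apply: (subgroupM (factor_subgroup i) zF).
  by move: yF; rewrite -iy.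
by case: v yv {rv} => // s v; rewrite /differ -iy.
Qed.

(** The property of sending elements represented by reduced words to such
    elements, in both directions, defines a subgroup. *)
Lemma reduced_exists g : exists2 w, reduced w & wval w = g.
Proof.
pose S := [set g | forall h, (exists2 w, reduced w & wval w = h) <->
                             (exists2 w, reduced w & wval w = g * h)].
suff /(_ 1) : S g by rewrite mulg1 => -[+ _]; apply; exists [::].
apply: free_product_ind g => [|i a]; rewrite /S.
  apply: subgroupI => /=.
  - by move=> h; rewrite mul1g.
  - by move=> x y Sx Sy h; rewrite -mulgA -Sx -Sy.
  - by move=> x Sx h; rewrite (Sx (x^-1 * h)) mulVKg.
move=> h; split=> -[w rw wh].
  have [|v rv vE] := @reduced_mul i (iota i a) w _ rw; first by exists a.
  by exists v; rewrite // vE wh.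
have [|v rv vE] := @reduced_mul i (iota i a)^-1 w _ rw.
  by apply: subgroupV; [exact: factor_subgroup|exists a].
by exists v; rewrite // vE wh mulKg.
Qed.

Theorem free_product_residually : residually C G.
Proof.
apply/(separableP hC) => g g1.
have [w rw wg] := reduced_exists g.
have [|K [f [CK fg]]] := reduced_separated rw.
  by move=> w0; apply: g1; rewrite -wg w0.
by exists K; exists f; split=> // _ ->; rewrite gmulf1 -wg => /esym.
Qed.

Definition inv_syl x : I * G := (x.1, x.2^-1).

Lemma wval_catrev u v : wval (catrev (map inv_syl u) v) = (wval u)^-1 * wval v.
Proof.
by elim: u v => [|x u IH] v /=; rewrite ?invg1 ?mul1g // IH /= invgM !mulgA.
Qed.

Lemma inv_syllable x : syllable (inv_syl x) = syllable x.
Proof.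
congr andb; last by rewrite /= invg_eq1.
apply/asboolP/asboolP => /= h; last by apply: subgroupV => //; exact: factor_subgroup.
by rewrite -[x.2]invgK; apply: subgroupV => //; exact: factor_subgroup.
Qed.

Lemma reduced_catrev x u y v : syllable x -> syllable y ->
  reduced (catrev (map inv_syl (x :: u)) (y :: v)) =
  [&& reduced (x :: u), differ x y & reduced (y :: v)].
Proof.
move=> sx sy; rewrite /reduced catrevE all_cat all_rev -catrevE all_map.
rewrite (eq_all (a2 := syllable)); last by move=> s /=; rewrite inv_syllable.
have -> : sorted differ (catrev (map inv_syl (x :: u)) (y :: v)) =
    [&& path differ x u, differ x y & path differ y v].
  elim: u x y v {sx sy} => [//|x' u IH] x y v.
  have {}IH : sorted differ (catrev (map inv_syl (x' :: u)) (inv_syl x :: y :: v)) = _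
    := IH x' (inv_syl x) (y :: v).
  rewrite [LHS]IH /= -[differ x' (inv_syl x)]/(differ x' x) [differ x' x]differC.
  rewrite -[differ (inv_syl x) y]/(differ x y).
  by case: (differ x x'); rewrite ?andbF.
rewrite /= sx sy /=.
by case: (all syllable u); case: (differ x y); case: (path differ x u); rewrite /= ?andbF.
Qed.

(** Twice the length of the common initial segment of two words in the tree of
    the free product, where leaving a common coset of a free_factor in different
    directions counts for half an edge. *)
Fixpoint overlap u v : nat :=
  match u, v with
  | x :: u', y :: v' =>
      if `[< x.1 = y.1 >] then (if x.2 == y.2 then (overlap u' v').+2 else 1%N) else 0%N
  | _, _ => 0%N
  end.

Lemma overlap_ultra u v w :
  (minn (overlap u v) (overlap v w) <= overlap u w)%N.
Proof.
elim: u v w => [|x u IH] [|y v] [|z w] //=; rewrite ?minn0 ?min0n //.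
case: (asboolP (x.1 = y.1)) => [->|xy]; last by rewrite min0n.
case: (asboolP (y.1 = z.1)) => yz; last by rewrite minn0.
have := IH v w; case: (x.2 =P y.2) => [->|xy2].
  by case: (y.2 == z.2) => h; lia.
case: (y.2 =P z.2) => [<-|_] h; last by case: (x.2 == z.2); lia.
by rewrite (introF eqP xy2); lia.
Qed.

Lemma reduced_mulV u v : reduced u -> reduced v ->
  exists w, [/\ reduced w, wval w = (wval u)^-1 * wval v &
    (size w + overlap u v = size u + size v)%N].
Proof.
elim: u v => [|x u IH] v.
  by move=> _ rv; exists v; rewrite /= invg1 mul1g addn0.
case: v => [|y v] ru rv.
  exists (catrev (map inv_syl (x :: u)) [::]); split.
  - move: ru; rewrite /reduced catrevE cats0 all_rev all_map.
    rewrite (eq_all (a2 := syllable)); last by move=> s /=; rewrite inv_syllable.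
    case/andP=> -> /= xu; rewrite rev_sorted.
    rewrite (eq_sorted (e' := differ)); last by move=> s s'; exact: differC.
    by rewrite /= path_map.
  - by rewrite wval_catrev.
  - by rewrite catrevE size_cat size_rev size_map addn0.
have [sx _ ru'] := and3P (etrans (esym (reduced_cons x u)) ru).
have [sy yv rv'] := and3P (etrans (esym (reduced_cons y v)) rv).
rewrite /=; case: asboolP => [xy|/differP xy]; last first.
  exists (catrev (map inv_syl (x :: u)) (y :: v)); split.
  - by rewrite reduced_catrev // ru xy rv.
  - by rewrite wval_catrev.
  - by rewrite catrevE size_cat size_rev size_map addn0.
case: eqP => xy2.
  have [w [rw ww sw]] := IH v ru' rv'; exists w; split=> //.
    by rewrite ww /= xy2 invgM mulgA mulgVK.
  by lia.
pose z := (y.1, x.2^-1 * y.2).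
have sz : syllable z.
  apply/andP; split; last by apply/eqP => /= /mulg1_eq; rewrite invgK.
  apply/asboolP; move: (sx) (sy) => /andP[/asboolP xF _] /andP[/asboolP yF _].
  apply: (subgroupM (factor_subgroup _) _ yF).
  by apply: (subgroupV (factor_subgroup _)); rewrite -xy.
have rz : reduced (z :: v) by rewrite reduced_cons sz rv' andbT.
exists (catrev (map inv_syl u) (z :: v)); split.
- case: u {IH} ru ru' => [//|x' u] ru ru'.
  rewrite reduced_catrev // ?ru' ?rz //=; last by case/andP: ru' => /andP[].
  move: ru; rewrite reduced_cons => /and3P[_ xx' _].
  by rewrite differC /differ /= -xy andbT.
- by rewrite wval_catrev /= invgM !mulgA.
- by rewrite catrevE size_cat size_rev size_map /=; lia.
Qed.

Definition len (g : G) : nat := size (s2val (cid2 (reduced_exists g))).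

Lemma overlap_le u v :
  (overlap u v <= (size u).*2)%N /\ (overlap u v <= (size v).*2)%N.
Proof.
elim: u v => [|x u IH] [|y v] //=.
by case: ifP => // _; case: ifP => // _; have := IH v; lia.
Qed.

Lemma len_wval w : reduced w -> len (wval w) = size w.
Proof.
rewrite /len; case: cid2 => v /= rv vw rw.
have [z [rz ze sz]] := reduced_mulV rv rw.
have z0 : z = [::] by apply: reduced_wval1 rz _; rewrite ze vw mulVg.
by have := overlap_le v w; rewrite z0 /= in sz; lia.
Qed.

Lemma len_mulV u v : reduced u -> reduced v ->
  (len ((wval u)^-1 * wval v)%g + overlap u v = size u + size v)%N.
Proof.
by move=> ru rv; have [w [rw <- <-]] := reduced_mulV ru rv; rewrite len_wval.
Qed.

Lemma len_tree : tree_length len.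
Proof.
split=> [x|x|x y z].
- split=> [|->]; last by rewrite -[1]/(wval [::]) len_wval.
  by have [w rw <-] := reduced_exists x; rewrite len_wval // => /size0nil ->.
- have [w rw <-] := reduced_exists x; rewrite len_wval //.
  have := @len_mulV w [::] rw isT; rewrite /= mulg1.
  by have [_] := overlap_le w [::]; rewrite /=; lia.
have [u ru <-] := reduced_exists x; have [v rv <-] := reduced_exists y.
have [w rw <-] := reduced_exists z; rewrite !len_wval //.
have := len_mulV ru rv; have := len_mulV ru rw; have := len_mulV rw rv.
by have := overlap_ultra u w v; lia.
Qed.

Lemma len_factor i z : free_factor i z -> z <> 1 -> len z = 1%N.
Proof.
move=> zF z1; have r : reduced [:: (i, z)].
  by rewrite /reduced /= !andbT; apply/andP; split; [apply/asboolP|apply/eqP].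
by have := len_wval r; rewrite /= mulg1.
Qed.

Lemma cyclic_axial x w : reduced (x :: w) -> differ x (last x w) ->
  axial len (wval (x :: w)).
Proof.
move=> rw xw; split; last by rewrite len_wval.
rewrite -wval_cat !len_wval // ?size_cat ?addnn //.
move: (rw); rewrite /reduced all_cat /= cat_path => /andP[-> /= ->] /=.
by rewrite andbT differC.
Qed.

Lemma len_infactor w : all infactor w -> (len (wval w) <= size w)%N.
Proof.
elim: w => [|x w IH] /=; first by rewrite -[1]/(wval [::]) len_wval.
case/andP=> /asboolP xF /IH {}IH; have := lenM len_tree x.2 (wval w).
have [->|x1] := pselect (x.2 = 1); first by rewrite mul1g; lia.
by rewrite (len_factor xF x1); lia.
Qed.

(** If the extreme syllables of the word of [c] shared a factor, then the word of
    [c * c] could be shortened. *)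
Lemma axial_cyclic c : axial len c ->
  exists x w, [/\ reduced (x :: w), wval (x :: w) = c & differ x (last x w)].
Proof.
have [[|x w] rw <-] := reduced_exists c; first by case; rewrite (len_wval rw).
case=> + _; rewrite (len_wval rw) => cc; exists x, w; split=> //.
apply/differP => xw; have := reduced_infactor rw.
case/lastP: w rw cc xw => [|w y] rw cc xw.
  case/andP=> /asboolP xF _; move: cc; rewrite /= mulg1.
  have := @len_infactor [:: (x.1, x.2 * x.2)]; rewrite /= mulg1 andbT => + cc.
  rewrite cc; suff : infactor (x.1, x.2 * x.2) by move=> + h => /h.
  by apply/asboolP; exact: (subgroupM (factor_subgroup _) xF xF).
rewrite last_rcons in xw; rewrite /= all_rcons => /and3P[xF yF wF].
have := @len_infactor (x :: w ++ (y.1, y.2 * x.2) :: rcons w y).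
rewrite /= all_cat /= all_rcons xF yF wF /= andbT size_cat /= size_rcons.
have yxF : infactor (y.1, y.2 * x.2).
  apply/asboolP; apply: subgroupM; [exact: factor_subgroup|exact/asboolP|].
  by rewrite /= -xw; apply/asboolP.
move/(_ yxF); rewrite wval_cat /= wval_rcons.
move: cc; rewrite /= wval_rcons size_rcons !mulgA => ->; lia.
Qed.

(** Normal form of a double coset of a factor. *)
Lemma double_coset i g : exists a b v, [/\ free_factor i a, free_factor i b, reduced v,
  g = a * wval v * b & forall x w, v = x :: w -> x.1 <> i /\ (last x w).1 <> i].
Proof.
have F1 := subgroup1 (factor_subgroup i).
have [w rw <-] := reduced_exists g.
have [a [v [aF rv -> vi]]] : exists a v, [/\ free_factor i a, reduced v,
    wval w = a * wval v & forall x w, v = x :: w -> x.1 <> i].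
  case: w rw => [|x w] rw; first by exists 1, [::]; rewrite mul1g.
  have [xi|xi] := pselect (x.1 = i); last first.
    by exists 1, (x :: w); split=> //; [rewrite mul1g|move=> ? ? [<-]].
  move: rw; rewrite reduced_cons => /and3P[/andP[/asboolP xF _] xw rw].
  exists x.2, w; split=> //; first by rewrite -xi.
  by move=> y u wE; move: xw; rewrite wE -xi => /differP/nesym.
case/lastP: v rv vi => [|v y] rv vi.
  by exists a, 1, [::]; split; rewrite ?mulg1.
have [yi|yi] := pselect (y.1 = i).
  exists a, y.2, v; split=> //.
  - have := reduced_infactor rv; rewrite all_rcons -yi => /andP[/asboolP //].
  - exact: reduced_rcons rv.
  - by rewrite wval_rcons mulgA.
  move=> x u vE; split; first by apply: (vi x (rcons u y)); rewrite vE.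
  move: rv; rewrite vE /reduced rcons_cons /= rcons_path -yi.
  by case/andP=> _ /andP[_ /differP].
exists a, 1, (rcons v y); split; rewrite ?mulg1 // => x u e; split; first exact: vi e.
by move/(congr1 (last x)): e; rewrite last_rcons /= => <-.
Qed.

Lemma reduced_factor_cons i z w : free_factor i z -> z <> 1 -> reduced w ->
  (forall x v, w = x :: v -> x.1 <> i) -> reduced ((i, z) :: w).
Proof.
move=> zF z1 rw wi; rewrite reduced_cons rw andbT; apply/andP; split.
  by apply/andP; split; [apply/asboolP|apply/eqP].
by case: w wi {rw} => // x v /(_ x v erefl) xi; apply/differP => /esym.
Qed.

Lemma reduced_factor_rcons i z x w : free_factor i z -> z <> 1 -> reduced (x :: w) ->
  (last x w).1 <> i -> reduced (rcons (x :: w) (i, z)).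
Proof.
rewrite /reduced all_rcons rcons_cons /= rcons_path => zF z1 /andP[-> ->] wi.
rewrite !andbT; apply/andP; split; last exact/differP.
by apply/andP; split; [apply/asboolP|apply/eqP].
Qed.

(** After normalising [x] in its double coset, conjugation by [x] would carry an
    edge at the base point to an edge at distance [len x], against the four-point
    condition unless [len x] vanishes. *)
Lemma factor_malnormal i (a x : G) : free_factor i a -> a <> 1 -> free_factor i (a ^ x) ->
  free_factor i x.
Proof.
have [b [d [v [bF dF rv -> vi]]]] := double_coset i x.
have Fi := factor_subgroup i.
have FJ (y z : G) : free_factor i y -> free_factor i z -> free_factor i (y ^ z).
  by move=> yF zF; rewrite conjE; do ![apply: subgroupM => //|apply: subgroupV => //].
rewrite !conjgM => aF a1 axF; set g := wval v in axF *.
set a1' := a ^ b in axF; set a2' := a1' ^ g in axF.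
have a1F : free_factor i a1' by exact: FJ.
have a2F : free_factor i a2' by have := FJ _ d^-1 axF (subgroupV Fi dF); rewrite conjgK.
have a1N : a1' <> 1 by move/eqP; rewrite conjg_eq1 => /eqP.
have a2N : a2' <> 1 by move/eqP; rewrite conjg_eq1 => /eqP.
have ga : a1' * g = g * a2' by exact: conjgC.
have lenS z : free_factor i z -> z <> 1 -> len (z * g)%g = (len g).+1.
  move=> zF z1; have r := reduced_factor_cons zF z1 rv (fun x w e => (vi x w e).1).
  by rewrite /g (len_wval rv) -[_ * _]/(wval ((i, z) :: v)) (len_wval r).
have hT := len_tree.
have d1 : dist len 1 (a1' * g) = (len g).+1 by rewrite dist1 lenS.
have d2 : dist len a1' g = (len g).+1.
  rewrite /dist lenS //; first exact: subgroupV.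
  by move/eqP; rewrite invg_eq1 => /eqP.
have d3 : dist len 1 a1' = 1%N by rewrite dist1 (len_factor a1F).
have d4 : dist len (a1' * g) g = 1%N by rewrite (distC hT) ga distMr (len_factor a2F).
have d5 : dist len (a1' * g) a1' = len g by rewrite (distC hT) distMr.
have := dist4 hT 1 (a1' * g) a1' g; rewrite d1 d2 d3 d4 d5 dist1 => g0.
have -> : g = 1 by apply/(tree_length_eq1 hT); lia.
by rewrite mulg1; apply: subgroupM.
Qed.

(** A subgroup whose elements are all elliptic fixes a point of the tree: if
    [a] lies in a factor and [h] does not, then [h] or [a * h] is hyperbolic,
    up to a conjugation that keeps [a] in the factor. *)
Lemma factor_or_axial (H : set G) : is_subgroup H -> (exists2 a, H a & a <> 1) ->
  (exists i g, forall h, H h -> free_factor i (h ^ g)) \/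
  (exists h g, H h /\ axial len (h ^ g)).
Proof.
move=> hH [a Ha a1]; have [w0 rw0 wa] := reduced_exists a.
have [|g [x [w [rw ww _ xw]]]] := cyclic_reduction rw0.
  by move=> w00; apply: a1; rewrite -wa w00.
rewrite {w0 rw0}wa in ww; case: xw => [w1|xw]; last first.
  by right; exists a, g; rewrite -ww; split=> //; apply: cyclic_axial.
set i := x.1; have bF : free_factor i (a ^ g).
  rewrite -ww w1 /= mulg1; move: rw; rewrite w1 reduced_cons.
  by case/and3P=> /andP[/asboolP].
have Fi := factor_subgroup i.
have b1 : a ^ g <> 1 by move/eqP; rewrite conjg_eq1 => /eqP.
have [all_i|/existsNP[h /not_implyP[Hh hF]]] :=
  pselect (forall h, H h -> free_factor i (h ^ g)); first by left; exists i, g.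
right; have [b [d [v [bbF dF rv hE vi]]]] := double_coset i (h ^ g).
case: v => [|y v] in rv hE vi.
  by case: hF; rewrite hE /= mulg1; apply: subgroupM.
have [yi vyi] := vi y v erefl.
have hJ : h ^ (g * b) = wval (y :: v) * (d * b).
  by rewrite conjgM hE conjE !mulgA mulVg mul1g.
have dbF : free_factor i (d * b) by exact: subgroupM.
have [db1|db1] := pselect (d * b = 1); last first.
  exists h, (g * b); split=> //; rewrite hJ.
  rewrite -[d * b]/((i, d * b).2) -wval_rcons rcons_cons.
  apply: cyclic_axial; first exact: reduced_factor_rcons.
  by rewrite last_rcons; apply/differP.
exists (a * h), (g * b); split; first exact: subgroupM.
rewrite conjMg hJ db1 mulg1 conjgM; set z := _ ^ b.
have zF : free_factor i z.
  by rewrite /z conjE; do ![apply: subgroupM => //|apply: subgroupV => //].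
have z1 : z <> 1 by move/eqP; rewrite conjg_eq1 => /eqP.
rewrite -[_ * _]/(wval ((i, z) :: y :: v)); apply: cyclic_axial.
  by apply: reduced_factor_cons => // ? ? [<-].
by apply/differP => /esym.
Qed.

End Residual.
End FreeProduct.

(** * Separability of subgroups *)

Lemma has_order_exists (X : groupType) (x : X) n : (0 < n)%N -> x ^+ n = 1 ->
  exists r, has_order x r.
Proof.
move=> n0 xn.
have ex : exists m, (0 < m)%N && (x ^+ m == 1) by exists n; rewrite n0 xn eqxx.
case: (ex_minnP ex) => r /andP[r0 /eqP xr] r_min; exists r; split=> // m m0 xm.
by apply: r_min; rewrite m0 xm eqxx.
Qed.

Lemma has_order_dvd (X : groupType) (x : X) r m : has_order x r -> 
  x ^+ m = 1 -> (r %| m)%N.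
Proof.
case=> r0 xr r_min xm; rewrite /dvdn -leqn0 leqNgt; apply/negP => m0.
have := r_min _ m0; rewrite leqNgt ltn_mod r0 => h.
suff : false by []; apply: h.
move: xm; rewrite {1}(divn_eq m r) mulnC expgnDr expgnA xr.
by rewrite (_ : 1 ^+ _ = 1) ?mul1g //; exact: expg1n.
Qed.

Lemma class_primes_element (C : groupType -> Prop) p : class_primes C p ->
  exists (T : groupType) (t : T), C T /\ forall m, t ^+ m = 1 -> (p %| m)%N.
Proof.
case=> pp [[X [CX /existsNP[x nx]]]|[X [x [n [CX xn pn]]]]].
  exists X, x; split=> // -[//|m] xm; case: nx; by exists m.+1.
exists X, (x ^+ (n %/ p)); split=> // m; rewrite -expgnA => /(has_order_dvd xn).
have n0 : (0 < n)%N by case: xn.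
by rewrite -{1}(divnK pn) dvdn_pmul2l // divn_gt0 ?prime_gt0 // dvdn_leq.
Qed.

Lemma residually_torsion (C : groupType -> Prop) (hC : root_class C)
    (X : groupType) (x : X) q : residually C X -> prime q -> ~ class_primes C q ->
  x ^+ q = 1 -> x = 1.
Proof.
move=> rX pq nq xq; apply: contrapT => x1.
have [K [s [CK sx]]] := residually_hom hC rX x1.
have sxq : s x ^+ q = 1 by rewrite -gmulfXn xq gmulf1.
have [r xr] := has_order_exists (prime_gt0 pq) sxq.
apply: nq; split=> //; right; exists K, (s x), r; split=> //.
have r1 : r != 1%N.
  by apply/eqP => r1; case: xr => _; rewrite r1 expg1.
by have /(prime_nt_dvdP pq r1) -> := has_order_dvd xr sxq.
Qed.

Lemma exp_dvd (X : groupType) (g x : X) d a b :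
  (forall m, g ^+ m = 1 -> (d %| m)%N) -> x = g ^+ a \/ x = g ^- a ->
  x = g ^+ b \/ x = g ^- b -> (d %| b)%N -> (d %| a)%N.
Proof.
move=> gd xa xb db.
have eqX a' b' : g ^+ a' = g ^+ b' -> (d %| a') = (d %| b')%N.
  wlog ab : a' b' / (b' <= a')%N.
    by move=> wl e; case: (leqP b' a') => [|/ltnW] /wl; [apply|move/(_ (esym e))].
  move=> e; rewrite -[in LHS](subnKC ab) dvdn_addl //.
  by apply: gd; rewrite expgnFr // e mulgV.
have eqXV : g ^+ a = g ^- b -> (d %| a)%N.
  move=> e; have : (d %| a + b)%N by apply: gd; rewrite expgnDr e mulVg.
  by rewrite dvdn_addl.
case: xa xb => -> [] e.
- by rewrite (eqX _ _ e).
- exact: eqXV.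
- by apply: eqXV; rewrite -e invgK.
- by rewrite (eqX _ _ (invg_inj e)).
Qed.

(** [k'] is the least positive exponent of a power of [c] in [S]. *)
Lemma powers_exp (X : groupType) (S : set X) (c : X) k : is_subgroup S ->
  (0 < k)%N -> S (c ^+ k) -> exists k', [/\ (0 < k')%N, S (c ^+ k') &
   forall m x, x = c ^+ m \/ x = c ^- m -> S x <-> (k' %| m)%N].
Proof.
move=> hS k0 Sk.
have ex : exists m, (0 < m)%N && `[< S (c ^+ m) >].
  by exists k; rewrite k0; apply/asboolP.
case: (ex_minnP ex) => r /andP[r0 /asboolP Sr] r_min; exists r; split=> //.
move=> m x xm.
have -> : S x <-> S (c ^+ m).
  case: xm => -> //; split; last exact: subgroupV.
  by rewrite -[X in _ -> S X]invgK; apply: subgroupV.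
split=> [Sm|/dvdnP[j ->]]; last by rewrite mulnC expgnA; apply: subgroupX.
rewrite /dvdn -leqn0 leqNgt; apply/negP => m0.
have := r_min (m %% r)%N; rewrite m0 leqNgt ltn_mod r0 => h.
suff : false by []; apply: h; apply/asboolP.
have -> : c ^+ (m %% r) = (c ^+ r ^+ (m %/ r))^-1 * c ^+ m.
  by rewrite {3}(divn_eq m r) [(m %/ r * r)%N]mulnC expgnDr expgnA mulKg.
by apply: subgroupM => //; apply: subgroupV => //; apply: subgroupX.
Qed.

(** Conjugation by [x] and by its inverse both map [c] to powers of [c], whose
    exponents multiply to 1 up to sign. *)
Lemma root_conj (X : groupType) (L : X -> nat) (c x : X) : tree_length L ->
  axial L c -> (forall z, commute z c -> powers c z) -> commute (c ^ x) c ->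
  c ^ x = c \/ c ^ x = c^-1.
Proof.
move=> hL ac cent cx.
have cx' : commute (c ^ x^-1) c.
  have e : (c ^ x * c) ^ x^-1 = (c * c ^ x) ^ x^-1 by congr conjg.
  by rewrite (conjMg (c ^ x) c) (conjMg c (c ^ x)) conjgK in e; apply: esym.
have [m cm] := cent _ cx; have [n cn] := cent _ cx'.
have : L c = (m * n * L c)%N.
  rewrite -[LHS](congr1 L (conjgK x c)).
  have -> : L ((c ^ x) ^ x^-1) = L ((c ^ x^-1) ^+ m).
    by case: cm => ->; rewrite ?conjVg ?(tree_lengthV hL) conjXg.
  have -> : L ((c ^ x^-1) ^+ m) = L ((c ^+ n) ^+ m).
    by case: cn => ->; rewrite ?expVgn ?(tree_lengthV hL).
  by rewrite -expgnA axialX // [(n * m)%N]mulnC.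
rewrite -[LHS]mul1n => /eqP; rewrite eqn_pmul2r ?ac.2 // eq_sym muln_eq1.
by case/andP=> /eqP m1 _; move: cm; rewrite m1 !expg1.
Qed.

Section Separation.
Variables (C : groupType -> Prop) (hC : root_class C).

Lemma separable_conj (X : groupType) (S : set X) g :
  separable C [set h ^ g | h in S] -> separable C S.
Proof.
move=> /(separableP hC) sS; apply/(separableP hC) => x Sx.
have [|K [s [CK sx]]] := sS (x ^ g); first by rewrite conj_setP conjgK.
exists K, s; split=> // y Sy e; apply: (sx (y ^ g)); first by exists y.
by rewrite !gmulfJ e.
Qed.

Lemma isolated_conj P (X : groupType) (S : set X) g :
  isolated P S -> isolated P [set h ^ g | h in S].
Proof.
move=> iS x q pq nq /conj_setP; rewrite conjXg => /(iS _ _ pq nq) Sx.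
exact/conj_setP.
Qed.

Lemma identity_conj (X : groupType) (S : set X) g :
  satisfies_nontrivial_identity S ->
  satisfies_nontrivial_identity [set h ^ g | h in S].
Proof.
case=> F [k [x [w [fx w1 law]]]]; exists F, k, x, w; split=> // phi phiS.
have cM : {morph (fun z => z ^ g^-1) : y z / y * z : X} by move=> y z; exact: conjMg.
have := law (hom_of cM \o phi) (fun i => (conj_setP _ _ _).1 (phiS i)).
by move=> /eqP; rewrite conjg_eq1 => /eqP.
Qed.

Section FreeProduct.
Variables (I : Type) (A : I -> groupType) (G : groupType).
Variable iota : forall i, ghom (A i) G.
Hypotheses (hG : is_free_product iota) (hA : forall i, residually C (A i)).
Let rG : residually C G := free_product_residually hG hC hA.
Let hL : tree_length (len hG) := len_tree hG hC hA.

(** Each passage to a wreath product multiplies the order of the image of [c]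
    by [p], provided no proper prefix of the cyclically reduced word of [c]
    commutes with [c] in the image. *)
Lemma axial_order p e c : class_primes C p -> axial (len hG) c ->
  (forall x, commute x c -> powers c x) ->
  exists (K : groupType) (f : ghom G K), C K /\
    forall m, f c ^+ m = 1 -> (p ^ e %| m)%N.
Proof.
move=> /class_primes_element [T [t [CT tp]]] ac cent.
have [x [w [rw wc xw]]] := axial_cyclic hC hA ac.
suff [K [f [CK _ fc]]] : exists (K : groupType) (f : ghom G K), [/\ C K,
    (forall u v, x :: w = u ++ v -> u <> [::] -> v <> [::] ->
       f [~ wval u, c] <> 1) & forall m, f c ^+ m = 1 -> (p ^ e %| m)%N].
  by exists K, f.
elim: e => [|e [K [f [CK fu fc]]]].
  set s := [seq [~ wval (take j (x :: w)), c] | j <- seq.iota 1 (size w)].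
  have [|K [f [CK fs]]] := separate_seq hC (s := s).
    move=> z /mapP[j]; rewrite mem_iota => j_lt ->; apply: (residually_hom hC rG).
    move/eqP/commgP => /cent [m um].
    have := reduced_catl (etrans (congr1 _ (cat_take_drop j (x :: w))) rw).
    move=> /(len_wval hG hC hA); rewrite size_take.
    have -> : len hG (wval (take j (x :: w))) = (m * len hG c)%N.
      by case: um => ->; rewrite ?(tree_lengthV hL) axialX.
    rewrite -wc (len_wval hG hC hA rw) /=; case: ifP => ?; case: (m) => *; lia.
  exists K, f; split=> // u v e u0 v0; apply: fs; apply/mapP; exists (size u).
    rewrite mem_iota; move/(congr1 size): e; rewrite /= size_cat.
    by case: (u) (v) u0 v0 => // ? ? [] //= *; lia.
  by rewrite e take_size_cat.
have [Phi [Phi2 Phi1]] := edge_lift hG f t x.1.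
exists (wreath T K), Phi; split; first exact: root_class_wreath.
  move=> u v uv u0 v0 /(congr1 (fun F : wreath T K => F.2)).
  by rewrite Phi2; apply: fu uv u0 v0.
move=> m Phim.
have fm : f c ^+ m = 1.
  by rewrite -gmulfXn -Phi2 gmulfXn Phim.
case: m Phim fm => [//|m'] ; set m := m'.+1 => Phim fm.
have [r fr] := has_order_exists (ltn0Sn m') fm.
have [r0 fr1 r_min] := fr.
have Phi_c n : (n < r)%N -> (Phi c).1 (f c ^+ n) = if n == 0%N then t^-1 else 1.
  move=> nr; rewrite -wc Phi1 ?(reduced_infactor rw) // wc.
    have -> : (f c ^+ n == 1) = (n == 0%N) => //.
    case: n nr => [|n] nr; first by rewrite expg0 !eqxx.
    by apply/eqP => /(r_min _ (ltn0Sn n)); rewrite leqNgt nr.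
  move=> u v uv u0 v0 e1; apply: (fu u v uv u0 v0); rewrite gmulfR.
  apply/eqP/commgP; have -> : f (wval u) = f c ^- n by rewrite (mulg1_eq e1).
  by apply/commute_sym/commuteV/commuteX.
have Phi_cX n : (n < r)%N -> (Phi (c ^+ n.+1)).1 1 = t^-1.
  elim: n => [|n IH] nr.
    by rewrite expg1 -(expg0 (f c)) Phi_c.
  rewrite expgSr gmulfM /= IH ?(ltnW nr) // Phi2 gmulfXn mul1g Phi_c //=.
  by rewrite mulg1.
have Phi_r : (Phi (c ^+ r)).1 1 = t^-1 by case: (r) r0 Phi_cX => // r' _; apply.
have Phi_q q : (Phi (c ^+ r ^+ q)).1 1 = t^-1 ^+ q.
  elim: q => [|q IH]; first by rewrite gmulf1.
  have frq : f (c ^+ r ^+ q) = 1 by rewrite !gmulfXn fr1; apply: expg1n.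
  by rewrite expgSr gmulfM /= IH Phi2 frq mul1g Phi_r -expgSr.
have rm := has_order_dvd fr fm.
rewrite -(divnK rm) mulnC expnSr dvdn_mul ?fc // tp //.
apply: invg_inj; rewrite invg1 -expVgn -Phi_q -expgnA mulnC divnK //.
by rewrite gmulfXn Phim.
Qed.
(** [H] stabilises the axis of [c], whose centralizer is cyclic.  An element
    that moves the axis, or that acts on it by an orientation no element of [H]
    has, is separated by a single inequality; the remaining ones are translates
    of [H] by powers of [c], and isolation leaves only primes of the class to
    tell these apart. *)
Lemma axis_stabiliser_separable (H : set G) c k : is_subgroup H ->
  axial (len hG) c -> (forall x, commute x c -> powers c x) ->
  (forall y, H y -> c ^ y = c \/ c ^ y = c^-1) -> (0 < k)%N -> H (c ^+ k) ->
  isolated (class_primes C) H -> separable C H.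
Proof.
move=> hH ac cent Hc k0 Hk iso; apply/(separableP hC) => x nHx.
have c2 : c * c <> 1.
  move/(tree_length_eq1 hL); rewrite ac.1; have := ac.2; lia.
have [cx|cx] := pselect (c ^ x = c \/ c ^ x = c^-1); last first.
  have [|K [f [CK fx]]] := @residually_hom C hC G [~ c ^ x, c] rG.
    by move/eqP/commgP => /(root_conj hL ac cent).
  exists K, f; split=> // y /Hc cy e; apply: fx.
  rewrite gmulfR gmulfJ -e -gmulfJ; apply/eqP/commgP.
  by case: cy => ->; [|rewrite gmulfV; apply/commute_sym/commuteV]; apply: commute_refl.
have [K [f [CK fc]]] := residually_hom hC rG c2.
(* [h] stands for [f], or for a homomorphism through which [f] factors. *)
have same (M : groupType) (h : ghom G M) y : (forall z, h z = 1 -> f z = 1) ->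
    H y -> h y = h x -> c ^ y = c ^ x.
  move=> hf /Hc cy e; have := gmulfJ h c y; rewrite e -gmulfJ => ecx.
  have ncc : h c <> h c^-1.
    by move=> ec; apply: fc; apply: hf; rewrite gmulfM {2}ec gmulfV mulgV.
  by case: cx cy ecx => -> [] -> // ?; case: ncc.
have [[y0 Hy0 cy0]|no_y] := pselect (exists2 y, H y & c ^ y = c ^ x); last first.
  exists K, f; split=> // y Hy e; apply: no_y; exists y => //.
  exact: same (fun _ => id) Hy e.
have diff y : c ^ y = c ^ x -> powers c (y * y0^-1).
  move=> cy; apply: cent; apply/commute_sym/commgP; rewrite -conjg_fix.
  by rewrite conjgM cy -cy0 conjgK.
have [r [r0 Hr rP]] := powers_exp hH k0 Hk.
have [m0 xm0] := diff x erefl.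
have nrm0 : ~ (r %| m0)%N.
  move/(rP m0 _ xm0) => h; apply: nHx; rewrite -[x](mulgVK y0).
  exact: subgroupM.
have [p [pr nprm0]] : exists p, p \in \pi(r) /\ ~ (r`_p %| m0)%N.
  apply: contra_notP nrm0 => no; apply/(dvdn_partP _ r0) => p pr.
  by apply: contrapT => h; apply: no; exists p.
have [pp pdr] : prime p /\ (p %| r)%N.
  by move: pr; rewrite mem_primes => /and3P[].
have Cp : class_primes C p.
  apply: contrapT => /(iso (c ^+ (r %/ p)) p pp).
  rewrite -expgnA divnK // => /(_ Hr) /(rP (r %/ p)%N _ (or_introl erefl)).
  have rp0 : (0 < r %/ p)%N by rewrite divn_gt0 ?prime_gt0 // dvdn_leq.
  by move=> /(dvdn_leq rp0); rewrite leqNgt ltn_Pdiv ?prime_gt1.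
have [K' [f' [CK' f'c]]] := axial_order (logn p r) Cp ac cent.
have [M [h [CM hP]]] := joint_hom hC f f' CK CK'.
exists M, h; split=> // y Hy e.
have cy : c ^ y = c ^ x.
  apply: same Hy e => z hz; rewrite -(@gmulf1 _ _ f); apply: (hP z 1 _).1.
  by rewrite hz gmulf1.
have [m1 ym1] := diff y cy.
apply: nprm0; rewrite p_part.
have fE z m : z = c ^+ m \/ z = c ^- m -> f' z = f' c ^+ m \/ f' z = f' c ^- m.
  by case=> ->; [left|right]; rewrite ?gmulfV gmulfXn.
apply: (exp_dvd f'c (fE _ _ xm0)).
  have -> : f' (x * y0^-1) = f' (y * y0^-1) by rewrite !gmulfM (hP _ _ e).2.
  exact: fE ym1.
rewrite -p_part; apply: (dvdn_trans (dvdn_part p r)).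
by apply/(rP m1 _ ym1); apply: subgroupM => //; apply: subgroupV.
Qed.

(** A retract of a residually [C]-group is separable: [f] and [f] after the
    retraction agree on the retract and disagree at a point outside. *)
Lemma factor_separable i (S : set (A i)) : separable C S ->
  separable C (iota i @` S).
Proof.
move=> /(separableP hC) sS; apply/(separableP hC) => x nSx.
have [r [rK _]] := retraction hG i.
have [Srx|/sS [K [f [CK fx]]]] := pselect (S (r x)); last first.
  exists K, (f \o r); split=> // _ [a Sa <-] /=; rewrite rK; exact: fx.
have nx : (iota i (r x))^-1 * x <> 1.
  by move/mulg1_eq; rewrite invgK => e; apply: nSx; exists (r x).
have [K [f [CK fx]]] := residually_hom hC rG nx.
have [M [h [CM hP]]] := joint_hom hC f (f \o iota i \o r) CK CK.
exists M, h; split=> // _ [a Sa <-] e; apply: fx.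
have [/= e1 e2] := hP _ _ e.
by rewrite gmulfM gmulfV -e2 -e1 rK mulVg.
Qed.

Lemma separable_factor i (S : set (A i)) : separable C (iota i @` S) ->
  separable C S.
Proof.
move=> /(separableP hC) sS; apply/(separableP hC) => a nSa.
have [|K [f [CK fa]]] := sS (iota i a).
  by case=> b Sb /(iota_inj hG) ba; rewrite ba in Sb.
exists K, (f \o iota i); split=> // b Sb; apply: fa; by exists b.
Qed.

(** An element with a nontrivial power in the factor centralises this power, so
    it lies in the factor by malnormality; [q]-torsion is absent from [G]. *)
Lemma factor_isolated i (S : set (A i)) : is_subgroup S ->
  isolated (class_primes C) S -> isolated (class_primes C) (iota i @` S).
Proof.
move=> hS iS x q pq nq [a Sa ax].
have [a1|a1] := pselect (x ^+ q = 1).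
  rewrite (residually_torsion hC rG pq nq a1).
  exact: subgroup1 (hom_image_subgroup _ hS).
have [b _ bx] : free_factor iota i x.
  apply: (factor_malnormal hG hC hA (a := x ^+ q)) => //; first by exists a.
  have -> : (x ^+ q) ^ x = x ^+ q.
    by apply/conjg_fixP/commgP/commute_sym/commuteX/commute_refl.
  by exists a.
exists b => //; apply: (iS b q pq nq).
suff -> : b ^+ q = a by [].
by apply: (iota_inj hG (i := i)); rewrite gmulfXn bx ax.
Qed.

(** The centralizer of [h] is generated by some [c].  As [H] preserves the axis
    of [h], it preserves that of [c]. *)
Lemma axial_separable (H : set G) h : is_subgroup H ->
  satisfies_nontrivial_identity H -> H h -> axial (len hG) h ->
  isolated (class_primes C) H -> separable C H.
Proof.
move=> hH idH Hh ah iso.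
have [c [ac [k hk] cent]] := centralizer_cyclic hL ah.
have ch : powers c h by exists k.
have cent' x : commute x c -> powers c x.
  by move=> xc; apply: cent; apply: powers_commute ch xc.
have h1 : h <> 1 by move/(tree_length_eq1 hL) => h0; have := ah.2; rewrite h0.
apply: (@axis_stabiliser_separable H c k) => //.
- move=> y Hy; apply: (root_conj hL) => //.
  suff : powers c (c ^ y).
    case=> m [->|->]; apply/commute_sym; [|apply: commuteV];
      exact/commuteX/commute_refl.
  apply: cent.
  have cyhy : commute (c ^ y) (h ^ y).
    rewrite /commute -!conjMg; congr conjg.
    exact: powers_commute ch (commute_refl c).
  case: (identity_axis hL hH idH ah Hh Hy) cyhy => -> // /commuteV.
  by rewrite invgK.
- by rewrite lt0n; apply/eqP => k0; case: hk; rewrite k0 ?invg1.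
- case: hk => [<- //|e]; rewrite -[_ ^+ k]invgK -e; exact: subgroupV.
Qed.
End FreeProduct.
End Separation.

Theorem mainTheorem1 (C : groupType -> Prop) (hC : root_class C)
    (I : Type) (A : I -> groupType) (hA : forall i, residually C (A i))
    (G : groupType) (iota : forall i, ghom (A i) G)
    (hG : is_free_product iota)
    (H : set G) (hH : is_subgroup H) (hid : satisfies_nontrivial_identity H) :
  defective C H <->
  exists (i : I) (H' : set (A i)) (g : G),
    [/\ is_subgroup H',
        H = [set h ^ g | h in iota i @` H'] &
        defective C H'].
Proof.
split=> [[iso nsep]|[i [H' [g [hH' -> [iso nsep]]]]]]; last first.
  split; first exact/isolated_conj/(factor_isolated hC hG hA).
  by move=> /(separable_conj hC)/(separable_factor hC hG).
have nontriv : exists2 a, H a & a <> 1.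
  apply: contra_notP nsep => triv.
  have rG := free_product_residually hG hC hA.
  suff -> : H = [set 1] by [].
  apply/seteqP; split=> [x Hx|_ ->]; last exact: subgroup1.
  by apply: contrapT => x1; apply: triv; exists x.
have [[i [g Fg]]|[h [g [Hh ah]]]] := factor_or_axial hG hC hA hH nontriv; last first.
  case: nsep; apply: (separable_conj hC (g := g)).
  apply: (axial_separable hC hA _ _ _ ah).
  - exact: conj_subgroup.
  - exact: identity_conj.
  - by exists h.
  - exact: isolated_conj.
pose H' := [set a | H (iota i a ^ g^-1)].
have HE : H = [set h ^ g^-1 | h in iota i @` H'].
  apply/seteqP; split=> [x Hx|_ [_ [a Ha <-] <-] //].
  have [a _ ax] := Fg x Hx; exists (x ^ g); last by rewrite conjgK.
  by exists a => //; rewrite /H' /= ax conjgK.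
exists i, H', g^-1; split=> //; last split.
- apply: subgroupI => [|a b Ha Hb|a Ha]; rewrite /H' /=.
  + by rewrite gmulf1 conj1g; apply: subgroup1.
  + by rewrite gmulfM conjMg; apply: subgroupM.
  + by rewrite gmulfV conjVg; apply: subgroupV.
- by move=> a q pq nq; rewrite /H' /= gmulfXn conjXg; apply: iso.
- move=> sH'; apply: nsep; apply: (separable_conj hC (g := g)).
  have -> : [set h ^ g | h in H] = iota i @` H'.
    rewrite {1}HE conj_set_comp mulVg; apply/seteqP; split=> [_ [x xH' <-]|x xH'].
      by rewrite conjg1.
    by exists x; rewrite ?conjg1.
  exact: factor_separable.
Qed.
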